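(* Let $K$ be an algebraically closed field, and let $n,d$ be integers with $2\le d<n$, $(n,d)=1$ and $(\mathrm{char}(K),d)=1$. Let $f(x)\in K[x]$ be a monic polynomial of degree $n$ without repeated roots, and let $\mathcal C_{f,d}$ be a smooth projective model of the smooth plane affine curve $C_{f,d}: y^d=f(x)$. (i) Let $P$ be a point of order $m>1$ on $\mathcal C_{f,d}$. Then either $m=d$ or $m\ge n$. (ii) Suppose that one of the following conditions holds: (1) $\mathrm{char}(K)=0$ and $d$ does not divide $n-1$; (2) $\mathrm{char}(K)=0$, $d=n-1$, and $n\ge 5$; (3) $\mathrm{char}(K)$ is a prime $p$ and $n$ is a power of $p$. Then there is at most one $n$-packet on $\mathcal C_{f,d}$, i.e., the number of points of order $n$ on $\mathcal C_{f,d}$ is either $0$ or $d$. (iii) Let $n=4$ and $d=n-1=3$, and suppose that $\mathrm{char}(K)\ne 2,3$. Then there are precisely two monic quartic polynomials $f(x)\in K[x]$ without repeated roots such that all the $K$-points on the curve $\mathcal C_{f,3}$ with $x$-coordinates $0$ and $-1$ have order $4$. Namely, $$f(x)=x^4+2\left(x+\frac{3+\sqrt3}{6}\right)^3=(x+1)^4+2\left(-x+\frac{-3+\sqrt3}{6}\right)^3,$$ where the two choices of $\sqrt3\in K$ give the two polynomials $f(x)$.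
   Context: The condition $(\mathrm{char}(K),d)=1$ means that $\mathrm{char}(K)$ does not divide $d$ (automatic in characteristic $0$). Since $(n,d)=1$, the smooth projective model $\mathcal C_{f,d}$ has exactly one point not lying on the affine curve $C_{f,d}$; it is denoted $\infty$, so $\mathcal C_{f,d}(K)=C_{f,d}(K)\sqcup\{\infty\}$. The curve $\mathcal C_{f,d}$ is embedded in its Jacobian $J(\mathcal C_{f,d})$ by sending $P$ to the linear equivalence class of the divisor $(P)-(\infty)$. A point $P\in\mathcal C_{f,d}(K)$ is said to have order $m$ if the class of $(P)-(\infty)$ has order exactly $m$ in the group $J(\mathcal C_{f,d})(K)$. Let $\mu_d\subset K$ be the group of $d$th roots of unity (cyclic of order $d$); $\gamma\in\mu_d$ acts on $\mathcal C_{f,d}$ by $(x,y)\mapsto(x,\gamma y)$ on $C_{f,d}$ and fixes $\infty$. For an integer $m>1$, an $m$-packet on $\mathcal C_{f,d}$ is a nontrivial $\mu_d$-orbit consisting of $m$-torsion $K$-points of $\mathcal C_{f,d}$ (each such packet consists of $d$ distinct points).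
   Formalization: In (iii), ''precisely two'' polynomials is claimed only for char(K) ≠ 11: in characteristic 11 the choice √3 = 6 gives x^4+2(x+7)^3, which has the double root 5, so the printed count fails there; the rest of (iii) is kept for all char(K) ≠ 2,3. *)

(* Defs.v *)
From Stdlib Require Import ClassicalEpsilon.
From HB Require Import structures.
From mathcomp Require Import all_boot all_order all_algebra.
From mathcomp Require Import qfpoly ring.
From mathcomp Require Import freeg.

Set Implicit Arguments.
Unset Strict Implicit.
Unset Printing Implicit Defensive.

Import Order.TTheory GRing.Theory Num.Theory.
Local Open Scope ring_scope.

Local Notation "x %:F" := (@FracField.tofrac _ x) : ring_scope.

Definition no_repeated_roots (K : fieldType) (f : {poly K}) : Prop :=
  forall a : K, ~~ (('X - a%:P) ^+ 2 %| f).

Section FunctionField.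
Variables (K : fieldType) (d : nat) (f : {poly K}).

(* The function field K(C_{f,d}) is K(x)[Y] / (Y^d - f(x)).  [qpoly] only
   provides a commutative ring with inverses of units; see [funfield_unit] below
   for the fact that it is a field. *)
Definition defining_poly : {poly {fraction {poly K}}} := 'X^d - (f%:F)%:P.

Definition funfield := {poly %/ defining_poly}.

Definition funconst (c : K) : funfield := qpolyC _ (c%:P)%:F.
Definition fun_x : funfield := qpolyC _ ('X)%:F.
Definition fun_y : funfield := qpolyX _.

End FunctionField.

Section Irreducibility.
Variables (K : fieldType) (n d : nat) (f : {poly K}).
Hypotheses (d_gt0 : (0 < d)%N) (co_nd : coprime n d) (szf : size f = n.+1).

Lemma defining_poly_monic : defining_poly d f \is monic.
Proof. exact: monicXnsubC. Qed.

Lemma size_defining_poly : size (defining_poly d f) = d.+1.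
Proof. exact: size_XnsubC. Qed.

Lemma companion_exists (F : fieldType) (q : {poly F}) :
  q \is monic -> (1 < size q)%N ->
  exists m (A : 'M[F]_m.+1), m.+2 = size q /\ char_poly A = q.
Proof.
move=> mq; have := companionmxK mq.
move: (companionmx q); case: (size q) => [|[|m]] //= A charA _.
by exists m, A.
Qed.

Lemma frac_ex (R : idomainType) (z : {fraction R}) :
  exists a b : R, b != 0 /\ z * b%:F = a%:F.
Proof.
elim/quotW: z => r; exists (frac r).1, (frac r).2; split; first exact: denom_ratioP.
rewrite /FracField.tofrac; unlock.
rewrite -[LHS]FracField.pi_mul; apply/eqmodP => /=.
rewrite FracField.equivfE /FracField.mulf.
by rewrite !numden_Ratio ?(oner_neq0, mulr1, mul1r) ?mulf_neq0 ?denom_ratioP ?oner_neq0 // mulrC.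
Qed.

Lemma defining_poly_irreducible : irreducible_poly (defining_poly d f).
Proof.
split=> [|q szq1 qdvd]; first by rewrite size_defining_poly ltnS.
have h0 : defining_poly d f != 0 by rewrite -size_poly_eq0 size_defining_poly.
have q0 : q != 0 by apply: contraNneq h0 => q0; rewrite -dvd0p -q0.
have lq0 : (lead_coef q)^-1 != 0 by rewrite invr_eq0 lead_coef_eq0.
have sz : (size q <= d.+1)%N by rewrite -size_defining_poly dvdp_leq.
have sq : (1 < size q)%N.
  by rewrite ltn_neqAle eq_sym szq1 size_poly_gt0.
pose p := (lead_coef q)^-1 *: q.
have szp : size p = size q by rewrite size_scale.
have mp : p \is monic by rewrite monicE lead_coefZ mulVf ?lead_coef_eq0.
have [m [A [Em charA]]] := companion_exists mp (etrans (congr1 _ szp) sq).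
have pdvd : p %| defining_poly d f by rewrite dvdpZl.
have: A ^+ d = (f%:F)%:M.
  have /dvdpP[r Er] := pdvd.
  have: horner_mx A (defining_poly d f) = 0.
    by rewrite Er rmorphM /= -charA Cayley_Hamilton mulr0.
  by rewrite rmorphB /= rmorphXn /= horner_mx_X horner_mx_C => /subr0_eq.
move/(congr1 determinant); rewrite det_scalar.
have -> : \det (A ^+ d) = \det A ^+ d.
  by elim: (d) => [|k IH]; rewrite ?expr0 ?det1 // !exprS det_mulmx IH.
have [a [b [b0 Eab]]] := frac_ex (\det A).
move=> E.
have : (a ^+ d)%:F = (f ^+ m.+1 * b ^+ d)%:F.
  by rewrite rmorphM !rmorphXn /= -Eab exprMn E.
move/eqP; rewrite tofrac_eq => /eqP E2.
have f0 : f != 0 by rewrite -size_poly_eq0 szf.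
have a0 : a != 0.
  apply/eqP => a0; move/eqP: E2; rewrite a0 expr0n gtn_eqF // eq_sym mulf_eq0.
  by rewrite !expf_eq0 (negPf f0) (negPf b0) !andbF.
move/(congr1 (fun u : {poly K} => (size u).-1)): E2.
rewrite size_mul ?expf_neq0 //.
have -> : (size (f ^+ m.+1) + size (b ^+ d)).-1.-1 =
          ((size (f ^+ m.+1)).-1 + (size (b ^+ d)).-1)%N.
  have : (0 < size (f ^+ m.+1))%N by rewrite size_poly_gt0 expf_neq0.
  have : (0 < size (b ^+ d))%N by rewrite size_poly_gt0 expf_neq0.
  by case: (size (f ^+ _)) => // i; case: (size (b ^+ _)) => // j _ _; rewrite /= addnS.
rewrite !size_exp szf /= => E3.
have: (d %| n * m.+1)%N.
  by rewrite -(dvdn_addl _ (dvdn_mull (size b).-1 (dvdnn d))) -E3 dvdn_mull.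
rewrite Gauss_dvdr 1?coprime_sym // => /(dvdn_leq (ltn0Sn m)) dm.
rewrite -dvdp_size_eqp // size_defining_poly eqn_leq sz -szp -Em ltnS.
exact: dm.
Qed.

Lemma funfield_unit (u : funfield d f) : u != 0 -> u \is a GRing.unit.
Proof.
exact: (coprimep_unit (defining_poly_irreducible, defining_poly_monic)).
Qed.

End Irreducibility.

Section Curve.
Variables (K : fieldType) (d : nat) (f : {poly K}).

Definition affine_point := {p : K * K | p.2 ^+ d == f.[p.1]}.

(* K-points of the smooth projective model: [None] is the point at infinity. *)
Definition point := option affine_point.

Definition infty : point := None.

(* Normalized discrete valuations of the function field, trivial on K; the value
   at 0 is irrelevant. *)
Definition is_valuation (v : funfield d f -> int) : Prop :=
  [/\ forall g h, g != 0 -> h != 0 -> v (g * h) = v g + v h,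
      forall g h, g != 0 -> h != 0 -> g + h != 0 ->
        Num.min (v g) (v h) <= v (g + h),
      forall c : K, c != 0 -> v (funconst d f c) = 0
    & exists t, t != 0 /\ v t = 1].

(* The local ring of the smooth projective model at [P] is the valuation ring
   whose maximal ideal contains x - a and y - b if [P] is the affine point
   (a, b), and the valuation ring not containing x if [P] is infinity. *)
Definition centered_at (P : point) (v : funfield d f -> int) : Prop :=
  match P with
  | Some p => 0 < v (fun_x d f - funconst d f (val p).1)
              /\ 0 < v (fun_y d f - funconst d f (val p).2)
  | None => v (fun_x d f) < 0
  end.

(* Order of vanishing at [P].  The valuation centered at [P] exists and is unique
   when the affine curve is smooth and deg f is coprime to d. *)
Definition ord (P : point) : funfield d f -> int :=
  epsilon (inhabits (fun=> 0)) (fun v => is_valuation v /\ centered_at P v).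

Definition divisor := {freeg point / int}.

Definition principal (D : divisor) : Prop :=
  exists2 h : funfield d f, h != 0 & forall P, coeff P D = ord P h.

Definition lin_equiv (D E : divisor) : Prop := principal (D - E).

(* The divisor (P) - (infty), whose class in Pic^0 = J(K) is the image of [P]
   under the embedding of the curve in its Jacobian. *)
Definition jac_divisor (P : point) : divisor := << P >> - << infty >>.

Definition torsion_point (m : nat) (P : point) : Prop :=
  lin_equiv (jac_divisor P *+ m) 0.

Definition has_order (P : point) (m : nat) : Prop :=
  [/\ (0 < m)%N, torsion_point m P
    & forall k, (0 < k < m)%N -> ~ torsion_point k P].

Lemma mu_act_subproof (g : {g : K | d.-unity_root g}) (p : affine_point) :
  (val g * (val p).2) ^+ d == f.[(val p).1].
Proof.
by case: g p => g /= /unity_rootP gd [p /= /eqP pf]; rewrite exprMn gd mul1r pf.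
Qed.

Definition mu_act (g : {g : K | d.-unity_root g}) (P : point) : point :=
  if P is Some p then Some (exist (fun q : K * K => q.2 ^+ d == f.[q.1])
                              ((val p).1, val g * (val p).2) (mu_act_subproof g p))
  else None.

Definition is_orbit (O : point -> Prop) : Prop :=
  exists P, forall Q, O Q <-> exists g, Q = mu_act g P.

Definition is_packet (m : nat) (O : point -> Prop) : Prop :=
  [/\ is_orbit O, exists P Q, [/\ O P, O Q & P <> Q]
    & forall P, O P -> torsion_point m P].

End Curve.

(* In [quartic s] and [quartic_alt s] the parameter [s] is a square root of 3. *)
Definition quartic (K : fieldType) (s : K) : {poly K} :=
  'X^4 + 2%:R * ('X + ((3%:R + s) / 6%:R)%:P) ^+ 3.

Definition quartic_alt (K : fieldType) (s : K) : {poly K} :=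
  ('X + 1) ^+ 4 + 2%:R * (- 'X + ((- 3%:R + s) / 6%:R)%:P) ^+ 3.

(* In characteristic 11 one of the two quartics has a double root. *)
Lemma quartic_char11 (K : fieldType) : 11%N \in [pchar K] ->
  (6%:R : K) ^+ 2 = 3%:R /\ ~ no_repeated_roots (quartic (6%:R : K)).
Proof.
move=> c11; have e11 : 11%:R = 0 :> K by rewrite (pcharf0 c11).
have n6 : 6%:R != 0 :> K by rewrite -(dvdn_pcharf c11).
split.
  have -> : (6%:R : K) ^+ 2 = 3%:R + 3%:R * 11%:R by ring.
  by rewrite e11 mulr0 addr0.
move/(_ 5%:R)/negP; apply.
have -> : quartic (6%:R : K) = 'X^4 + 2%:R * ('X + 7%:R) ^+ 3.
  rewrite /quartic; congr (_ + _ * (_ + _) ^+ 3).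
  rewrite -[RHS]polyC_natr; congr _%:P.
  apply: (mulIf n6); rewrite mulfVK //.
  have -> : (7%:R : K) * 6%:R = 3%:R + 6%:R + 3%:R * 11%:R by ring.
  by rewrite e11 mulr0 addr0.
have E11 : 11%:R = 0 :> {poly K} by rewrite -polyC_natr e11.
apply/dvdpP; exists ('X^2 + 'X + 5%:R).
rewrite polyC_natr.
have -> : 'X^4 + 2%:R * ('X + 7%:R) ^+ 3 =
    ('X^2 + 'X + 5%:R) * ('X - 5%:R) ^+ 2
    + 11%:R * ('X^3 + 2%:R * 'X^2 + 29%:R * 'X + 51%:R) :> {poly K} by ring.
by rewrite E11 mul0r addr0.
Qed.

(* Main.v *)
From Stdlib Require Import ClassicalEpsilon.
Require Import Defs.
From HB Require Import structures.
From mathcomp Require Import all_boot all_order all_algebra all_field.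
From mathcomp Require Import zify ring.
From mathcomp Require Import freeg.

(** The affine ring [K[x, y]] of the curve is integrally closed, so a function
    regular away from infinity is a polynomial [sum_(i < d) g_i(x) y^i]; its pole
    order at infinity is the maximum of the numbers [d deg g_i + n i], which are
    pairwise distinct because [n] and [d] are coprime.

    If [P = (a, b)] has order [m < n], the function with divisor [m(P) - m(infty)]
    is thus a polynomial in [x] alone; since it vanishes on the whole fibre over
    [a], that fibre is the single point [P], whence [b = 0] and [m = d].  If
    [m = n], the function is [y - g(x)] up to a scalar, and taking its norm to
    [K(x)] shows that [P] has order [n] iff [f = g^d + (x - a)^n] and [b = g(a)]
    for some [g] with [d deg g < n].

    Two packets of order [n] over [a1 <> a2] give
    [g1^d - g2^d = (x - a2)^n - (x - a1)^n].  In characteristic 0 the right-hand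
    side has degree [n - 1], so that [d] divides [n - 1].  If [d = n - 1], then
    [g1] and [g2] are linear and the normalized coefficients of the left-hand side
    satisfy a linear recurrence of order two, while those of the right-hand side
    are [n c^k / k]; three consecutive instances of the recurrence are incompatible
    (invertibility of a Hilbert matrix), and for [n = 4] the two available
    instances determine [g1] up to the choice of a square root of 3.  If [n] is a
    power of the characteristic, the right-hand side is constant, so [g1] and [g2]
    are constant and [f] is an [n]-th power. *)

Set Implicit Arguments.
Unset Strict Implicit.
Unset Printing Implicit Defensive.

Import Order.TTheory GRing.Theory Num.Theory.
Local Open Scope ring_scope.

(** * The equation f = g^d + (x - a)^n *)

Lemma closed_root_exp (K : closedFieldType) (m : nat) (c : K) : (0 < m)%N ->
  exists b, b ^+ m = c.
Proof.
move=> m0; have [b /rootP] : exists b, root ('X^m - c%:P) b.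
  by apply/closed_rootP; rewrite size_XnsubC // eqSS -lt0n.
by rewrite !hornerE => /eqP; rewrite subr_eq0 => /eqP; exists b.
Qed.

Lemma natr_neq0_pchar (K : fieldType) (d : nat) : (0 < d)%N ->
  (forall p, p \in [pchar K] -> ~~ (p %| d)%N) -> d%:R != 0 :> K.
Proof.
move=> d0 dK; apply/negP => z; have [p pK] := natf0_pchar d0 z.
by have := dK p pK; rewrite (dvdn_pcharf pK) z.
Qed.

(** [X^d - 1] is separable because [d] is invertible in [K]; its roots are multiplied by one fixed
    root [be] of [X^d - c]. *)
Lemma nth_roots (K : closedFieldType) (d : nat) (c : K) :
  (0 < d)%N -> d%:R != 0 :> K -> c != 0 ->
  exists s : seq K, [/\ uniq s, size s = d & forall b, (b \in s) = (b ^+ d == c)].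
Proof.
move=> d0 dK c0.
have [r Er] := closed_field_poly_normal ('X^d - 1 : {poly K}).
have l1 : lead_coef ('X^d - 1 : {poly K}) = 1 by rewrite -polyC1; apply/monicP; exact: monicXnsubC.
rewrite l1 scale1r in Er.
have ur : uniq r by rewrite -separable_prod_XsubC -Er separable_Xn_sub_1.
have sr : size r = d.
  have := congr1 (fun p : {poly K} => size p) Er.
  by rewrite size_prod_XsubC size_Xn_sub_1 // => -[].
have [be Ebe] := closed_root_exp c d0.
have be0 : be != 0 by apply: contraNneq c0 => b0; rewrite -Ebe b0 expr0n eqn0Ngt d0.
exists [seq be * z | z <- r]; split; rewrite ?size_map //.
  by rewrite map_inj_uniq //; exact: mulfI.
move=> b; have -> : b = be * (b / be) by rewrite mulrCA mulfV ?mulr1.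
rewrite mem_map; last exact: mulfI.
rewrite exprMn Ebe -root_prod_XsubC -Er /root !hornerE subr_eq0.
by rewrite -(inj_eq (mulfI c0)) mulr1.
Qed.

Lemma single_root_power (K : closedFieldType) (q : {poly K}) a :
  q != 0 -> (forall z, root q z -> z = a) ->
  q = lead_coef q *: ('X - a%:P) ^+ (size q).-1.
Proof.
move=> q0 H; have [r Er] := closed_field_poly_normal q.
have lq0 : lead_coef q != 0 by rewrite lead_coef_eq0.
have Ear : r = nseq (size r) a.
  apply/all_pred1P/allP => z zr; apply/eqP/H.
  by rewrite Er rootZ // root_prod_XsubC.
have Eq : q = lead_coef q *: ('X - a%:P) ^+ (size r).
  rewrite {1}Er; congr (_ *: _); rewrite Ear big_nseq size_nseq.
  by elim: (size r) => [|k IH] //=; rewrite exprS IH.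
by rewrite {1 3}Eq size_scale // size_exp_XsubC.
Qed.

Lemma coef_linear_exp (R : comNzRingType) (p q : R) m i :
  ((p%:P * 'X + q%:P) ^+ m)`_i = p ^+ i * q ^+ (m - i) *+ 'C(m, i).
Proof.
have -> : (p%:P * 'X + q%:P) ^+ m = \poly_(j < m.+1) (p ^+ j * q ^+ (m - j) *+ 'C(m, j)).
  rewrite addrC exprDn poly_def; apply: eq_bigr => j _.
  by rewrite exprMn -!polyC_exp mulrA -polyCM mul_polyC scalerMnl mulrC.
by rewrite coef_poly ltnS; case: leqP => // lt; rewrite bin_small ?mulr0n.
Qed.

Lemma linear_poly (R : nzRingType) (g : {poly R}) :
  (size g <= 2)%N -> g = (g`_1)%:P * 'X + (g`_0)%:P.
Proof.
move=> sg; apply/polyP => i; rewrite coefD coefC coefCM coefX.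
case: i => [|[|i]] /=; rewrite ?mulr0 ?mulr1 ?add0r ?addr0 //.
by rewrite nth_default // (leq_trans sg).
Qed.

(* Given [g(a) <> 0], the norm of [y - g(x)] to [K(x)] is then [(x - a)^n], up to
   sign, so [y - g(x)] has divisor [n(P) - n(infty)] with [P = (a, g(a))]. *)
Definition power_split (K : fieldType) (n d : nat) (f : {poly K}) (a : K) (g : {poly K}) :=
  (d * (size g).-1 < n)%N /\ f = g ^+ d + ('X - a%:P) ^+ n.

Section Uniqueness.
Variables (K : closedFieldType) (n d : nat) (f : {poly K}).
Hypotheses (d_gt1 : (1 < d)%N) (dn : (d < n)%N) (dK : d%:R != 0 :> K).
Variables (a1 a2 : K) (g1 g2 : {poly K}).
Hypotheses (split1 : power_split n d f a1 g1) (split2 : power_split n d f a2 g2).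

Let diff : g1 ^+ d - g2 ^+ d = ('X - a2%:P) ^+ n - ('X - a1%:P) ^+ n.
Proof.
have [_ E1] := split1; have [_] := split2; rewrite E1 => E2.
have -> : g1 ^+ d = g2 ^+ d + ('X - a2%:P) ^+ n - ('X - a1%:P) ^+ n by rewrite -E2 addrK.
by ring.
Qed.

Let coef_diff i : (g1 ^+ d)`_i - (g2 ^+ d)`_i =
  ((- a2) ^+ (n - i) - (- a1) ^+ (n - i)) *+ 'C(n, i).
Proof.
have X a : 'X - a%:P = 1%:P * 'X + (- a)%:P :> {poly K} by rewrite mul1r polyCN.
by rewrite -coefB diff !X coefB !coef_linear_exp !expr1n !mul1r mulrnBl.
Qed.

(** The degree of [g^d] is a multiple of [d] below [n], hence not [n - 1]. So the left-hand side of
    [diff] has no term in [x^(n-1)], while on the right its coefficient is [n (a1 - a2)]. *)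
Lemma split_unique_degree : n%:R != 0 :> K -> ~~ (d %| n.-1)%N -> a1 = a2.
Proof.
move=> nK dvd; have := coef_diff n.-1.
have z (g : {poly K}) : (d * (size g).-1 < n)%N -> (g ^+ d)`_n.-1 = 0.
  move=> lt; apply: nth_default.
  have : (size (g ^+ d)).-1 <> n.-1.
    by rewrite size_exp => E; rewrite -E dvdn_mull in dvd.
  rewrite size_exp mulnC => ne; have := size_exp g d; rewrite mulnC; move: lt ne dn.
  by move: (size (g ^+ d)) (d * _)%N; clear; lia.
rewrite !z ?(proj1 split1) ?(proj1 split2) // subrr.
have n0 : (0 < n)%N by apply: leq_trans dn.
have -> : (n - n.-1)%N = 1%N by move: n0; clear; lia.
have -> : 'C(n, n.-1) = n by rewrite -{1}(prednK n0) binSn prednK.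
move/esym/eqP; rewrite -mulr_natr mulf_eq0 (negPf nK) orbF !expr1 opprK addrC.
by rewrite subr_eq0 => /eqP.
Qed.

(** By Frobenius [(x - a)^n = x^n - a^n], so [g1^d - g2^d] is a constant, nonzero if [a1 <> a2]. Its
    divisors [g1 - z g2], for [z^d = 1], are then constant; two values of [z] make [g2] constant,
    and [f] becomes the [n]-th power of a linear polynomial, against the absence of repeated
    roots. *)
Lemma split_unique_pchar p k : no_repeated_roots f -> p \in [pchar K] -> n = (p ^ k)%N ->
  a1 = a2.
Proof.
move=> f_simple pK En; apply/eqP/negPn/negP => a12.
have n0 : (0 < n)%N by apply: leq_trans dn.
have pnat (R : comNzRingType) : p \in [pchar R] -> [pchar R].-nat n.
  move=> pR; rewrite En (eq_pnat _ (pcharf_eq pR)) pnatX pnat_id //.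
  exact: pcharf_prime pK.
have Xn a : ('X - a%:P) ^+ n = 'X^n - (a ^+ n)%:P :> {poly K}.
  have nP : [pchar {poly K}].-nat n by apply: pnat; rewrite pchar_poly.
  have Na : (- a) ^+ n = - a ^+ n.
    apply/eqP; rewrite -addr_eq0 -exprDn_pchar ?pnat // addNr expr0n.
    by rewrite eqn0Ngt n0.
  by rewrite -polyCN exprDn_pchar // -polyC_exp Na polyCN.
pose c := a1 ^+ n - a2 ^+ n.
have c0 : c != 0.
  apply: contra a12; rewrite /c subr_eq0 => /eqP c0.
  have := congr1 (fun r : {poly K} => r.[a2]) (Xn a1).
  rewrite !hornerE /= c0 subrr => /eqP.
  by rewrite expf_eq0 n0 subr_eq0 eq_sym.
have const z : z ^+ d = 1 -> exists e, g1 - z%:P * g2 = e%:P.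
  move=> zd; have : g1 ^+ d - (z%:P * g2) ^+ d = c%:P.
    by rewrite exprMn -polyC_exp zd mul1r diff !Xn /c polyCB; ring.
  rewrite subrXX => /(congr1 (fun r : {poly K} => size r)); rewrite size_polyC c0 => E.
  exists (g1 - z%:P * g2)`_0; apply: size1_polyC.
  have : (g1 - z%:P * g2) * (\sum_(i < d) g1 ^+ (d.-1 - i) * (z%:P * g2) ^+ i) != 0.
    by rewrite -size_poly_gt0 E.
  rewrite mulf_eq0 => /norP[x0 y0]; move: E x0 y0; clear; rewrite -!size_poly_gt0.
  move=> E x0 y0; move: E; rewrite size_mul -?size_poly_gt0 //.
  by move: x0 y0; move: (size _) (size _) => x y; case: x => // x; case: y => // y; lia.
(* A second root of unity exists because [d > 1] and [d] is invertible. *)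
have [z z1 zd] : exists2 z : K, z != 1 & z ^+ d = 1.
  have [s [us ss sP]] := nth_roots (ltnW d_gt1) dK (oner_neq0 K).
  have [z zs z1] : exists2 z, z \in s & z != 1.
    apply/hasP; apply: contraTT d_gt1 => /hasPn H; rewrite -ss -leqNgt.
    by apply: (uniq_leq_size (s2 := [:: 1])) => // x /H; rewrite negbK inE.
  by exists z => //; apply/eqP; rewrite -sP.
have [x Ex] := const 1 (expr1n _ _); have [y Ey] := const z zd.
have zz : z - 1 != 0 by rewrite subr_eq0.
have Eg2 : g2 = ((x - y) / (z - 1))%:P.
  have zz' : (z - 1)%:P != 0 :> {poly K} by rewrite polyC_eq0.
  apply: (mulfI zz'); rewrite -polyCM mulrCA mulfV // mulr1 !polyCB -Ex -Ey polyC1.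
  by ring.
set e := (x - y) / (z - 1) in Eg2.
(* With [g2 = e] one has [f = x^n - (a2^n - e^d)], which Frobenius turns into [(x - r)^n]. *)
have [r Er] := closed_root_exp (a2 ^+ n - e ^+ d) n0.
case/negP: (f_simple r).
have -> : f = ('X - r%:P) ^+ n.
  by rewrite (proj2 split2) Eg2 !Xn Er -polyC_exp polyCB; ring.
by rewrite dvdp_exp2l // (leq_trans d_gt1 (ltnW dn)).
Qed.

End Uniqueness.

(** * Differences of powers of two linear polynomials *)

Section LinearPowers.
Variables (K : fieldType) (d : nat) (p1 q1 p2 q2 c : K).
Local Notation w m := (p1 ^+ (d - m) * q1 ^+ m - p2 ^+ (d - m) * q2 ^+ m).

(** [w m] is the coefficient of [x^(d-m)] on the left, divided by the binomial [C(d, m)]. The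
    identity [(m+1) C(d+1, m+1) = (d+1) C(d, m)] makes the same binomial appear on the right, where
    it cancels. *)
Lemma linear_powers_coef m :
  (p1%:P * 'X + q1%:P) ^+ d - (p2%:P * 'X + q2%:P) ^+ d
    = ('X + c%:P) ^+ d.+1 - 'X^(d.+1) :> {poly K} ->
  (m <= d)%N -> 'C(d, m)%:R != 0 :> K ->
  m.+1%:R * w m = d.+1%:R * c ^+ m.+1.
Proof.
move=> E md Cdm; have := congr1 (fun r : {poly K} => r`_(d - m)) E.
have -> : 'X + c%:P = 1%:P * 'X + c%:P by rewrite mul1r.
rewrite !coefB !coef_linear_exp coefXn subKn // bin_sub //.
have -> : (d - m == d.+1)%N = false by apply/eqP; clear -md; lia.
have -> : (d.+1 - (d - m))%N = m.+1 by clear -md; lia.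
have -> : 'C(d.+1, d - m) = 'C(d.+1, m.+1).
  by rewrite -bin_sub ?leqW ?leq_subr //; congr 'C(_, _); clear -md; lia.
rewrite subr0 expr1n mul1r -mulrnBl => Em.
have binE : (m.+1 * 'C(d.+1, m.+1) = d.+1 * 'C(d, m))%N by rewrite -mul_bin_diag.
apply: (mulIf Cdm); transitivity (m.+1%:R * (w m *+ 'C(d, m))).
  by rewrite -[w m *+ _]mulr_natr mulrA.
rewrite Em -[c ^+ _ *+ _]mulr_natr mulrCA -natrM binE natrM.
by ring.
Qed.

Hypothesis (moment : forall m, (m <= d)%N -> 'C(d, m)%:R != 0 :> K ->
  m.+1%:R * w m = d.+1%:R * c ^+ m.+1).

Local Notation P := (p1 * p2).
Local Notation Q := (q1 * q2).
Local Notation E := (p1 * q2 + p2 * q1).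

(* [w] satisfies the linear recurrence with characteristic roots [q1 / p1] and [q2 / p2]. *)
Lemma linear_powers_rec m : (m.+2 <= d)%N -> P * w m.+2 - E * w m.+1 + Q * w m = 0.
Proof.
move=> md; have -> : (d - m)%N = (d - m.+2).+2 by clear -md; lia.
have -> : (d - m.+1)%N = (d - m.+2).+1 by clear -md; lia.
by rewrite !exprS; ring.
Qed.

(** If all three vanish, one of the two linear polynomials is zero, so [w] is geometric up to sign
    and [w 1 ^ 2 = w 0 * w 2]. This is incompatible with [(m+1) w m = (d+1) c^(m+1)] for
    [m = 0, 1, 2]. *)
Lemma linear_powers_nondegenerate : (2 <= d)%N -> d.+1%:R != 0 :> K -> c != 0 ->
  d%:R != 0 :> K -> 'C(d, 2)%:R != 0 :> K ->
  ~ [/\ P = 0, Q = 0 & E = 0].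
Proof.
move=> d2 NK c0 dK C2 [P0 Q0 E0].
have m0 := moment (leq0n d) _; rewrite bin0 oner_neq0 in m0.
have m1 := moment (ltnW d2) _; rewrite bin1 in m1.
have m2 := moment d2 C2; have {}m0 := m0 isT; have {}m1 := m1 dK.
have wE : w 1%N ^+ 2 = w 0%N * w 2%N.
  have e0 : (d - 0)%N = (d - 2).+2 by clear -d2; lia.
  have e1 : (d - 1)%N = (d - 2).+1 by clear -d2; lia.
  rewrite e0 e1; have : (p1 == 0) && (q1 == 0) || (p2 == 0) && (q2 == 0).
    move/eqP: P0 E0; rewrite mulf_eq0 => /orP[]/eqP z.
      rewrite z mul0r add0r => /eqP; rewrite mulf_eq0 => /orP[]/eqP z'; move: Q0.
        by move=> /eqP; rewrite mulf_eq0 z' eqxx => /orP[]->; rewrite ?orbT.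
      by rewrite z' !eqxx.
    rewrite z mul0r addr0 => /eqP; rewrite mulf_eq0 => /orP[]/eqP z'; move: Q0.
      by move=> /eqP; rewrite mulf_eq0 z' eqxx => /orP[]->; rewrite ?orbT.
    by rewrite z' !eqxx orbT.
  by case/orP => /andP[/eqP-> /eqP->]; rewrite !exprS; ring.
(* Since [1 = 4 - 3], the left-hand side equals [12 (w 0 * w 2 - w 1 ^ 2)]; this avoids dividing by
   2 or 3. *)
have : d.+1%:R ^+ 2 * c ^+ 4 = 0.
  have -> : d.+1%:R ^+ 2 * c ^+ 4 = 4 * (d.+1%:R * c ^+ 1) * (d.+1%:R * c ^+ 3) -
     3 * (d.+1%:R * c ^+ 2) ^+ 2 by ring.
  by rewrite -m0 -m1 -m2 exprMn wE; ring.
by move/eqP; rewrite mulf_eq0 !expf_eq0 (negPf NK) (negPf c0) !andbF.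
Qed.

(** Substituting the moments into the recurrences for [m = 0, 1, 2] gives a homogeneous linear
    system in [Q], [E c], [P c^2] whose matrix is, up to signs, the 3 by 3 Hilbert matrix. All three
    unknowns vanish, which contradicts [linear_powers_nondegenerate]. *)
Lemma linear_powers_degree : (4 <= d)%N -> (forall m, m.+1%:R != 0 :> K) -> c = 0.
Proof.
move=> d4 K0; apply/eqP/negPn/negP => c0.
have CK m : (m <= d)%N -> 'C(d, m)%:R != 0 :> K.
  by move=> md; rewrite -(prednK (n := 'C(d, m))) ?bin_gt0.
have M m (md : (m <= d)%N) := moment md (CK m md).
have N0 := K0 d; set N : K := d.+1%:R in N0 M.
have r0 := linear_powers_rec (m := 0%N) (ltnW (ltnW d4)).
have r1 := linear_powers_rec (m := 1%N) (ltnW d4).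
have r2 := linear_powers_rec (m := 2%N) d4.
have M0 := M 0%N (leq0n _); have M1 := M 1%N (ltnW (ltnW (ltnW d4))).
have M2 := M 2%N (ltnW (ltnW d4)); have M3 := M 3%N (ltnW d4); have M4 := M 4%N d4.
move: r0 r1 r2 M0 M1 M2 M3 M4; move: (w 0%N) (w 1%N) (w 2%N) (w 3%N) (w 4%N) => w0 w1 w2 w3 w4.
move=> r0 r1 r2 M0 M1 M2 M3 M4.
(* The three recurrences are multiplied by 6, 12 and 60, so that each [w m] appears with its factor
   [m + 1]. *)
have s0 : 2 * P * c ^+ 2 - 3 * E * c + 6 * Q = 0.
  apply: (mulfI (mulf_neq0 N0 c0)); rewrite mulr0.
  transitivity (2 * P * (N * c ^+ 3) - 3 * E * (N * c ^+ 2) + 6 * Q * (N * c ^+ 1)); first by ring.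
  by rewrite -M0 -M1 -M2 -[RHS](mulr0 6) -r0; ring.
have s1 : 3 * P * c ^+ 2 - 4 * E * c + 6 * Q = 0.
  apply: (mulfI (mulf_neq0 N0 (expf_neq0 2 c0))); rewrite mulr0.
  transitivity (3 * P * (N * c ^+ 4) - 4 * E * (N * c ^+ 3) + 6 * Q * (N * c ^+ 2)); first by ring.
  by rewrite -M1 -M2 -M3 -[RHS](mulr0 12) -r1; ring.
have s2 : 12 * P * c ^+ 2 - 15 * E * c + 20 * Q = 0.
  apply: (mulfI (mulf_neq0 N0 (expf_neq0 3 c0))); rewrite mulr0.
  transitivity (12 * P * (N * c ^+ 5) - 15 * E * (N * c ^+ 4) + 20 * Q * (N * c ^+ 3)); first by ring.
  by rewrite -M2 -M3 -M4 -[RHS](mulr0 60) -r2; ring.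
(* The weights 5, -15 and 3 eliminate [E] and [Q]. *)
have Pc : P * c ^+ 2 = 0.
  transitivity (5 * (2 * P * c ^+ 2 - 3 * E * c + 6 * Q)
     - 15 * (3 * P * c ^+ 2 - 4 * E * c + 6 * Q)
     + 3 * (12 * P * c ^+ 2 - 15 * E * c + 20 * Q)); first by ring.
  by rewrite s0 s1 s2; ring.
have Ec : E * c = 0.
  transitivity (P * c ^+ 2 - ((3 * P * c ^+ 2 - 4 * E * c + 6 * Q)
     - (2 * P * c ^+ 2 - 3 * E * c + 6 * Q))); first by ring.
  by rewrite s0 s1 Pc; ring.
have Q6 : 6 * Q = 0.
  transitivity ((2 * P * c ^+ 2 - 3 * E * c + 6 * Q) - 2 * (P * c ^+ 2) + 3 * (E * c)).
    by ring.
  by rewrite s0 Pc Ec; ring.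
apply: linear_powers_nondegenerate => //.
- exact: ltnW (ltnW _).
- by rewrite -(prednK (n := d)) // (leq_trans _ d4).
- exact: CK (ltnW (ltnW _)).
split.
- by move/eqP: Pc; rewrite mulf_eq0 expf_eq0 (negPf c0) andbF orbF => /eqP.
- by move/eqP: Q6; rewrite mulf_eq0 (negPf (K0 5%N)) => /eqP.
- by move/eqP: Ec; rewrite mulf_eq0 (negPf c0) orbF => /eqP.
Qed.

End LinearPowers.

(** The bound [d deg g < d + 1] makes both polynomials at most linear. Translating by [a1] turns
    [(x - a1)^(d+1)] into [x^(d+1)], which is the shape required by [linear_powers_coef] with
    [c = a1 - a2]. *)
Lemma split_linear_moments (K : fieldType) (d : nat) (f : {poly K}) a1 a2 g1 g2 :
  (2 <= d)%N -> power_split d.+1 d f a1 g1 -> power_split d.+1 d f a2 g2 ->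
  exists p1 q1 p2 q2, g1 \Po ('X + a1%:P) = p1%:P * 'X + q1%:P /\
  forall m, (m <= d)%N -> 'C(d, m)%:R != 0 :> K ->
    m.+1%:R * (p1 ^+ (d - m) * q1 ^+ m - p2 ^+ (d - m) * q2 ^+ m)
      = d.+1%:R * (a1 - a2) ^+ m.+1.
Proof.
move=> d2 [s1 E1] [s2 E2].
have lin (g : {poly K}) : (d * (size g).-1 < d.+1)%N ->
    g \Po ('X + a1%:P) = ((g \Po ('X + a1%:P))`_1)%:P * 'X + ((g \Po ('X + a1%:P))`_0)%:P.
  move=> sg; apply: linear_poly; rewrite size_comp_poly2 ?size_XaddC //.
  move: sg; rewrite ltnS -{2}(muln1 d) leq_pmul2l; last exact: ltnW.
  by case: (size g).
exists (g1 \Po ('X + a1%:P))`_1, (g1 \Po ('X + a1%:P))`_0.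
exists (g2 \Po ('X + a1%:P))`_1, (g2 \Po ('X + a1%:P))`_0.
split; first exact: lin.
move=> m; apply: linear_powers_coef.
rewrite -(lin g1 s1) -(lin g2 s2) -!rmorphXn -rmorphB /=.
have -> : g1 ^+ d - g2 ^+ d = ('X - a2%:P) ^+ d.+1 - ('X - a1%:P) ^+ d.+1.
  have -> : g1 ^+ d = g2 ^+ d + ('X - a2%:P) ^+ d.+1 - ('X - a1%:P) ^+ d.+1.
    by rewrite -E2 E1 addrK.
  by ring.
rewrite rmorphB !rmorphXn !rmorphB /= !comp_polyX !comp_polyC addrK.
by congr (_ ^+ _ - _); ring.
Qed.

Lemma split_unique_linear (K : fieldType) (d : nat) (f : {poly K}) a1 a2 g1 g2 :
  (4 <= d)%N -> (forall m, m.+1%:R != 0 :> K) ->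
  power_split d.+1 d f a1 g1 -> power_split d.+1 d f a2 g2 -> a1 = a2.
Proof.
move=> d4 K0 S1 S2; have d2 : (2 <= d)%N by apply: leq_trans d4.
have [p1 [q1 [p2 [q2 [_ M]]]]] := split_linear_moments d2 S1 S2.
by apply/eqP; rewrite -subr_eq0; apply/eqP; exact: (linear_powers_degree M).
Qed.

(** * The splitting equation for n = 4 and d = 3 *)

Section Quartic.
Variable K : fieldType.
Hypotheses (K2 : 2 != 0 :> K) (K3 : 3 != 0 :> K).

Let K4 : 4 != 0 :> K.
Proof. by rewrite (_ : 4 = 2 * 2 :> K) ?mulf_neq0 //; ring. Qed.

Let K6 : 6 != 0 :> K.
Proof. by rewrite (_ : 6 = 2 * 3 :> K) ?mulf_neq0 //; ring. Qed.

(** For [d = 3] the recurrence is available only for [m = 0] and [m = 1], which yields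
    [E = P = 6 Q]. Hence [q1 / p1] and [q2 / p2] are the two roots of [6 r^2 - 6 r + 1], that is
    [(3 + s) / 6] for the two square roots [s] of 3; the moments 0 and 1 then determine [p1^3]. *)
Lemma cubic_moments (p1 q1 p2 q2 : K) :
  (forall m, (m <= 3)%N -> 'C(3, m)%:R != 0 :> K ->
    m.+1%:R * (p1 ^+ (3 - m) * q1 ^+ m - p2 ^+ (3 - m) * q2 ^+ m) = 4 * 1 ^+ m.+1) ->
  exists s, [/\ s ^+ 2 = 3, p1 ^+ 3 = 2 & q1 = p1 * ((3 + s) / 6)].
Proof.
move=> M.
have r0 := @linear_powers_rec _ 3 p1 q1 p2 q2 0%N isT.
have r1 := @linear_powers_rec _ 3 p1 q1 p2 q2 1%N isT.
have C0 : 'C(3, 0)%:R != 0 :> K by exact: oner_neq0.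
have C1 : 'C(3, 1)%:R != 0 :> K by [].
have C2 : 'C(3, 2)%:R != 0 :> K by [].
have C3 : 'C(3, 3)%:R != 0 :> K by exact: oner_neq0.
have nd := linear_powers_nondegenerate M isT K4 (oner_neq0 K) K3 C2.
have {}M m : (m <= 3)%N -> 'C(3, m)%:R != 0 :> K ->
    m.+1%:R * (p1 ^+ (3 - m) * q1 ^+ m - p2 ^+ (3 - m) * q2 ^+ m) = 4.
  by move=> m3 Cm; rewrite (M m m3 Cm) expr1n mulr1.
have M0 := M 0%N isT C0; have M1 := M 1%N isT C1.
have M2 := M 2%N isT C2; have M3 := M 3%N isT C3.
have [EP Q6] : p1 * q2 + p2 * q1 = p1 * p2 /\ 6 * (q1 * q2) = p1 * p2.
  move: (p1 * p2) (q1 * q2) (p1 * q2 + p2 * q1) r0 r1 => P Q E.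
  move: M0 M1 M2 M3; move: (_ - _) (_ - _) (_ - _) (_ - _) => w3 w2 w1 w0 h0 h1 h2 h3 r0 r1.
  have s0 : 2 * P - 3 * E + 6 * Q = 0.
    apply: (mulfI K4); rewrite mulr0.
    transitivity (2 * P * (3 * w2) - 3 * E * (2 * w1) + 6 * Q * (1 * w0)).
      by rewrite h0 h1 h2; ring.
    by rewrite -[RHS](mulr0 6) -r0; ring.
  have s1 : 3 * P - 4 * E + 6 * Q = 0.
    apply: (mulfI K4); rewrite mulr0.
    transitivity (3 * P * (4 * w3) - 4 * E * (3 * w2) + 6 * Q * (2 * w1)).
      by rewrite h1 h2 h3; ring.
    by rewrite -[RHS](mulr0 12) -r1; ring.
  have EP : E = P.
    transitivity (P - ((3 * P - 4 * E + 6 * Q) - (2 * P - 3 * E + 6 * Q))); first by ring.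
    by rewrite s0 s1; ring.
  split=> //; transitivity (P + (2 * P - 3 * E + 6 * Q)); last by rewrite s0 addr0.
  by rewrite EP; ring.
have P0 : p1 * p2 != 0.
  apply/eqP => P0; case: nd; split=> //; last by rewrite EP.
  by move/eqP: Q6; rewrite P0 mulf_eq0 (negPf K6) => /eqP.
move: P0; rewrite mulf_eq0 negb_or => /andP[p10 p20].
pose r := q1 / p1; have Eq1 : q1 = p1 * r by rewrite /r mulrCA mulfV ?mulr1.
have Eq2 : q2 = p2 * (1 - r).
  apply: (mulfI p10); transitivity (p1 * q2 + p2 * q1 - p2 * q1); first by ring.
  by rewrite EP Eq1; ring.
have r6 : 6 * (r * (1 - r)) = 1.
  by apply: (mulfI (mulf_neq0 p10 p20)); rewrite mulr1 -{2}Q6 Eq1 Eq2; ring.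
have s2 : (6 * r - 3) ^+ 2 = 3.
  transitivity (9 - 6 * (6 * (r * (1 - r)))); first by ring.
  by rewrite r6; ring.
exists (6 * r - 3); split=> //; last first.
  by rewrite Eq1; congr (_ * _); apply: (mulIf K6); rewrite mulfVK //; ring.
(* Eliminating [p2^3] between the moments 0 and 1 leaves [p1^3 (2 r - 1) = 2 (2 r - 1)]; here
   [2 r = 1] would give [s = 0], hence [3 = 0]. *)
have X0 : (p1 ^+ 3 - 2) * (2 * r - 1) = 0.
  apply: (mulfI K2); rewrite mulr0.
  transitivity (2 * (p1 ^+ (3 - 1) * q1 ^+ 1 - p2 ^+ (3 - 1) * q2 ^+ 1) - 4
    + 2 * (1 - r) * (4 - 1 * (p1 ^+ (3 - 0) * q1 ^+ 0 - p2 ^+ (3 - 0) * q2 ^+ 0))).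
    by rewrite Eq1 Eq2 /=; ring.
  by rewrite M0 M1; ring.
move/eqP: X0; rewrite mulf_eq0 !subr_eq0 => /orP[/eqP //|/eqP r2].
case/eqP: K3; rewrite -s2.
have -> : 6 * r - 3 = 3 * (2 * r - 1) by ring.
by rewrite r2 subrr mulr0 expr0n.
Qed.

Lemma quartic_split_sqrt3 (f g1 g2 : {poly K}) :
  power_split 4 3 f 0 g1 -> power_split 4 3 f (-1) g2 ->
  exists2 s, s ^+ 2 = 3 & f = quartic s.
Proof.
move=> S1 S2; have [p1 [q1 [p2 [q2 [Eg M]]]]] := split_linear_moments (d := 3) isT S1 S2.
rewrite opprK add0r in M; have [s [s2 p13 Eq1]] := cubic_moments M.
exists s => //; rewrite (proj2 S1) polyC0 subr0 addrC /quartic; congr (_ + _).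
move: Eg; rewrite polyC0 addr0 comp_polyXr => ->.
rewrite Eq1 polyCM -mulrDr exprMn -polyC_exp p13.
by rewrite polyC_natr.
Qed.

(** The form in which [s ^+ 2 = 3] enters [quartic_altE] and [quartic_no_repeated_roots]: a
    quadratic equation for the shift [u = (3 + s) / 6]. *)
Lemma sqrt3_root (s : K) : s ^+ 2 = 3 ->
  6 * ((3 + s) / 6) ^+ 2 - 6 * ((3 + s) / 6) + 1 = 0 :> K.
Proof.
move=> s2; set u := (3 + s) / 6; have Es : s = 6 * u - 3.
  by rewrite /u mulrCA mulfV // mulr1 addrC addKr.
apply: (mulfI K6); rewrite mulr0.
transitivity ((6 * u - 3) ^+ 2 - 3); first by ring.
by rewrite -Es s2 subrr.
Qed.

Lemma quartic_altE (s : K) : s ^+ 2 = 3 -> quartic s = quartic_alt s.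
Proof.
move=> s2; have := sqrt3_root s2; rewrite /quartic /quartic_alt; set u := (3 + s) / 6 => Eu.
have -> : (- 3 + s) / 6 = u - 1.
  apply: (mulIf K6); rewrite mulrBl !mulfVK // /u; ring.
have EU : 6 * u%:P ^+ 2 - 6 * u%:P + 1 = 0 :> {poly K}.
  have := congr1 (@polyC K) Eu; rewrite polyCD polyCB !polyCM polyC0 polyC1.
  by rewrite !polyC_natr.
rewrite polyCB polyC1; set U := u%:P in EU *.
apply/eqP; rewrite -subr_eq0; apply/eqP.
transitivity ((2 * 'X + 1) * (6 * U ^+ 2 - 6 * U + 1)); first by ring.
by rewrite EU mulr0.
Qed.

Lemma sqrt3_neq0 (s : K) : s ^+ 2 = 3 -> s != 0.
Proof. by move=> s2; apply: contraNneq K3 => s0; rewrite -s2 s0 expr0n. Qed.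

(** The coefficient of [x^2] is [6 u = 3 + s]. *)
Lemma quartic_inj (s t : K) : quartic s = quartic t -> s = t.
Proof.
move=> /(congr1 (fun r : {poly K} => r`_2)); rewrite /quartic.
have C (u : K) : ('X^4 + 2 * ('X + u%:P) ^+ 3)`_2 = 6 * u.
  have -> : 'X + u%:P = 1%:P * 'X + u%:P :> {poly K} by rewrite polyC1 mul1r.
  rewrite coefD coefXn -polyC_natr coefCM coef_linear_exp expr1n mul1r expr1.
  by rewrite /= add0r (_ : 'C(3, 2) = 3%N) // -[u *+ _]mulr_natr; ring.
by rewrite !C => /(mulfI K6) /(mulIf (invr_neq0 K6)) /addrI.
Qed.

Lemma quartic_monic (s : K) : quartic s \is monic /\ size (quartic s) = 5%N.
Proof.
have sz : (size (2 * ('X + ((3 + s) / 6)%:P) ^+ 3 : {poly K})%R <= 4)%N.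
  rewrite -[2]polyC_natr mul_polyC (leq_trans (size_scale_leq _ _)) //.
  by rewrite -[_%:P]opprK -polyCN size_exp_XsubC.
split; last by rewrite /quartic size_polyDl size_polyXn.
by rewrite /quartic monicE lead_coefDl ?lead_coefXn // size_polyXn ltnS.
Qed.

(** At a double root [a] the polynomial and its derivative vanish; eliminating [a^4] leaves
    [a = - u], which forces [u = 0], or [a = - 4 u]. The latter gives [128 u = 27], and
    [6 u^2 - 6 u + 1 = 0] becomes [22 = 0]: this is where characteristic 11 is exceptional. *)
Lemma quartic_no_repeated_roots (s : K) : 11 != 0 :> K -> s ^+ 2 = 3 ->
  no_repeated_roots (quartic s).
Proof.
move=> K11 s2 a; apply/negP => /dvdpP [r Er].
have := sqrt3_root s2; rewrite /quartic in Er; set u := (3 + s) / 6 in Er * => Eu.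
have u0 : u != 0.
  by apply: contra_eq_neq Eu => ->; rewrite expr0n !mulr0 subr0 add0r oner_neq0.
have := congr1 (fun q : {poly K} => q.[a]) Er.
have := congr1 (fun q : {poly K} => q^`().[a]) Er.
rewrite -[2 in LHS]polyC_natr !derivE !hornerE /= subrr !(mulr0, mul0r, addr0, expr0n) /=.
move=> D V.
have A : 2 * a ^+ 3 + 3 * (a + u) ^+ 2 = 0.
  apply: (mulfI K2); rewrite mulr0.
  transitivity (a ^+ 3 + a ^+ 3 + a ^+ 3 + a ^+ 3 +
    2 * ((a + u) * (a + u) + (a + u) * (a + u + a + u))); first by ring.
  by rewrite D; ring.
have /eqP : (a + u) ^+ 2 * (4 * (a + u) - 3 * a) = 0.
  transitivity (2 * (a ^+ 4 + (1 + 1) * (a + u) * (a + u) * (a + u))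
    - a * (2 * a ^+ 3 + 3 * (a + u) ^+ 2)); first by ring.
  by rewrite V A; ring.
rewrite mulf_eq0 expf_eq0 /= => /orP[/eqP t0|/eqP t3].
  move: A; rewrite t0 expr0n mulr0 addr0 => /eqP.
  rewrite mulf_eq0 (negPf K2) expf_eq0 /= => /eqP a0.
  by move: t0; rewrite a0 add0r => /eqP; rewrite (negPf u0).
have Ea : a = - (4 * u) by rewrite -[LHS]subr0 -t3; ring.
have U : 128 * u = 27.
  apply: (mulfI (expf_neq0 2 u0)); apply/eqP; rewrite -subr_eq0 -oppr_eq0; apply/eqP.
  by rewrite -A Ea; ring.
have : 2 * 11 != 0 :> K by rewrite mulf_neq0.
case/eqP; transitivity (128 ^+ 2 * (6 * u ^+ 2 - 6 * u + 1)); last by rewrite Eu mulr0.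
transitivity (6 * (128 * u) ^+ 2 - 6 * 128 * (128 * u) + 128 ^+ 2); last by ring.
by rewrite U; ring.
Qed.

End Quartic.

(** * Valuations *)

Lemma mulrn_int (x : int) (k : nat) : x *+ k = x * k%:Z.
Proof. by rewrite -mulr_natr natz. Qed.

Lemma ltz_nmul (c : int) (i j : nat) : c < 0 -> (i < j)%N -> c * j%:Z + 1 <= c * i%:Z.
Proof. move=> c0 ij; rewrite lezD1 ltr_nM2l //; lia. Qed.

Lemma pole_order_split (n d : nat) (x y e : int) : (0 < d)%N -> x < 0 -> y * d%:Z = x * n%:Z -> 
   x = e * d%:Z -> 0 < - e /\ y = - (- e * n%:Z).
Proof.
move=> d0 x0 E Ex; split.
  by move: x0; rewrite Ex pmulr_llt0 ?oppr_gt0 // ltz_nat.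
have dz : d%:Z != 0 by lia.
by apply: (mulIf dz); rewrite E Ex; ring.
Qed.

(** Serves to normalize valuations: when all values are multiples of [e > 0] and the value 1 is
    attained, [e = 1]. *)
Lemma int_dvd1 (e b : int) : 0 < e -> e * b = 1 -> e = 1.
Proof.
move=> e0 E; have : e \is a GRing.unit by apply/unitrP; exists b; rewrite mulrC E.
by rewrite qualifE /=; lia.
Qed.

Section Valuation.
Variables (K : fieldType) (L : comUnitRingType) (cst : {rmorphism K -> L}).
Hypothesis L_unit : forall u : L, u != 0 -> u \is a GRing.unit.

Lemma mulL_neq0 (u w : L) : u != 0 -> w != 0 -> u * w != 0.
Proof.
move=> u0 w0; apply: contraNneq w0 => uw0.
by rewrite -[w](mulKr (L_unit u0)) uw0 mulr0.
Qed.

Lemma mulLI (u w z : L) : u != 0 -> u * w = u * z -> w = z.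
Proof. by move=> u0 E; rewrite -[w](mulKr (L_unit u0)) E mulKr ?L_unit. Qed.

Lemma expL_neq0 (u : L) k : u != 0 -> u ^+ k != 0.
Proof.
by move=> u0; elim: k => [|k IH]; rewrite ?oner_eq0 // exprS mulL_neq0.
Qed.

Definition valuation (v : L -> int) : Prop :=
  [/\ forall g h, g != 0 -> h != 0 -> v (g * h) = v g + v h,
      forall g h, g != 0 -> h != 0 -> g + h != 0 ->
        Num.min (v g) (v h) <= v (g + h),
      forall c : K, c != 0 -> v (cst c) = 0
    & exists t, t != 0 /\ v t = 1].

Variable v : L -> int.
Hypothesis valv : valuation v.

Lemma valM u w : u != 0 -> w != 0 -> v (u * w) = v u + v w.
Proof. by have [H _ _ _] := valv; apply: H. Qed.

Lemma valC c : c != 0 -> v (cst c) = 0.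
Proof. by have [_ _ H _] := valv; apply: H. Qed.

Lemma cst_neq0 c : c != 0 -> cst c != 0.
Proof. by rewrite fmorph_eq0. Qed.

Lemma val1 : v 1 = 0.
Proof. by rewrite -(rmorph1 cst) valC ?oner_eq0. Qed.

Lemma valN u : u != 0 -> v (- u) = v u.
Proof.
move=> u0; rewrite -mulN1r -(rmorph1 cst) -rmorphN valM ?cst_neq0 ?oppr_eq0 ?oner_eq0 //.
by rewrite valC ?add0r // oppr_eq0 oner_eq0.
Qed.

Lemma valX u k : u != 0 -> v (u ^+ k) = v u *+ k.
Proof.
move=> u0; elim: k => [|k IH]; first by rewrite expr0 val1.
by rewrite exprS valM ?expL_neq0 // IH mulrS.
Qed.

Definition vge (c : int) (u : L) := (u == 0) || (c <= v u).

Lemma vgeW c c' u : c' <= c -> vge c u -> vge c' u.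
Proof. by rewrite /vge => h /orP[->//|/(le_trans h) ->]; rewrite orbT. Qed.

Lemma vge_val u : vge (v u) u.
Proof. by rewrite /vge lexx orbT. Qed.

Lemma vgeP c u : u != 0 -> vge c u -> c <= v u.
Proof. by rewrite /vge => /negPf->. Qed.

Lemma vge0 c : vge c 0.
Proof. by rewrite /vge eqxx. Qed.

Lemma vgeD c u w : vge c u -> vge c w -> vge c (u + w).
Proof.
rewrite /vge; case: (eqVneq u 0) => [->|u0] /=; first by rewrite add0r.
case: (eqVneq w 0) => [->|w0] /= cu; first by rewrite addr0 cu orbT.
move=> cw; case: (eqVneq (u + w) 0) => //= uw0.
have [_ H _ _] := valv; apply: le_trans (H _ _ u0 w0 uw0).
by rewrite le_min cu.
Qed.

Lemma vge_sum c I (r : seq I) (P : pred I) (F : I -> L) :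
  (forall i, P i -> vge c (F i)) -> vge c (\sum_(i <- r | P i) F i).
Proof.
by move=> H; apply: (big_ind (fun u => vge c u)) => //; [exact: vge0 | exact: vgeD].
Qed.

Lemma vgeM c c' u w : vge c u -> vge c' w -> vge (c + c') (u * w).
Proof.
rewrite /vge; case: (eqVneq u 0) => [->|u0] /=; first by rewrite mul0r eqxx.
case: (eqVneq w 0) => [->|w0] /= cu; first by rewrite mulr0 eqxx.
by move=> cw; rewrite valM // lerD ?orbT.
Qed.

(** If [u + w] had larger value than [u], then so would [u = (u + w) - w]. *)
Lemma val_dominant u w : u != 0 -> vge (v u + 1) w -> u + w != 0 /\ v (u + w) = v u.
Proof.
move=> u0 vw; have uw0 : u + w != 0.
  apply/eqP => /(canRL (addKr u)); rewrite addr0 => Ew.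
  move: vw; rewrite Ew => /(vgeP (u := - u)).
  by rewrite oppr_eq0 u0 valN // => /(_ isT); lia.
split=> //; apply/eqP; rewrite eq_le; apply/andP; split; last first.
  apply: vgeP => //; apply: vgeD; first exact: vge_val.
  by apply: vgeW vw; lia.
rewrite leNgt; apply/negP => lt.
suff : vge (v u + 1) ((u + w) + (-1) * w) by rewrite mulN1r addrK => /(vgeP u0); lia.
apply: vgeD; first by apply: vgeW (vge_val _); lia.
rewrite -[v u + 1]add0r; apply: vgeM => //; rewrite /vge.
by rewrite valN ?oner_eq0 // val1 lexx orbT.
Qed.

Lemma val_dominant_sum (I : finType) (F : I -> L) i :
  F i != 0 -> (forall j, j != i -> vge (v (F i) + 1) (F j)) ->
  \sum_j F j != 0 /\ v (\sum_j F j) = v (F i).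
Proof.
move=> Fi0 H; rewrite (bigD1 i) //=; apply: val_dominant => //.
exact: vge_sum.
Qed.

End Valuation.

(** * The place at infinity *)

Section Weight.
Variables (K : fieldType) (n d : nat).
Hypotheses (d_gt0 : (0 < d)%N) (co_nd : coprime n d).
Implicit Types (p q : {poly K}) (g h : {poly {poly K}}).

(* Sends [x] to [t^d] and [y] to [t^n], the pole orders at infinity. *)
Definition weight_poly g : {poly K} := (map_poly (comp_poly 'X^d) g).['X^n].
Local Notation phi := weight_poly.

Lemma weight_polyM g h : phi (g * h) = phi g * phi h.
Proof. by rewrite /phi rmorphM hornerM. Qed.

Lemma weight_polyD g h : phi (g + h) = phi g + phi h.
Proof. by rewrite /phi rmorphD hornerD. Qed.

Lemma weight_polyC q : phi q%:P = q \Po 'X^d.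
Proof. by rewrite /phi map_polyC hornerC. Qed.

Lemma weight_polyXn k : phi 'X^k = 'X^(n * k).
Proof. by rewrite /phi map_polyXn hornerXn exprM. Qed.

Definition weight_term g i : {poly K} := (g`_i \Po 'X^d) * 'X^(n * i).
Local Notation tau := weight_term.

Lemma weight_poly_sum m g : (size g <= m)%N -> phi g = \sum_(i < m) tau g i.
Proof.
move=> sg; rewrite /phi (@horner_coef_wide _ m).
  by apply: eq_bigr => i _; rewrite coef_map /= /tau exprM.
by apply: leq_trans sg; exact: size_poly.
Qed.

Lemma weight_term_mod g i N : (tau g i)`_N != 0 -> N = n * i %[mod d].
Proof.
rewrite /tau coefMXn; case: ltnP; rewrite ?eqxx // => le.
rewrite coef_comp_poly_Xn //; case: ifP; rewrite ?eqxx // => dv _.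
by apply/eqP; rewrite eqn_mod_dvd.
Qed.

Lemma coprime_mod_inj i j : (i < d)%N -> (j < d)%N -> n * i = n * j %[mod d] -> i = j.
Proof.
wlog le : i j / (i <= j)%N.
  by move=> H hi hj e; case: (leqP i j) => [|/ltnW] l; [|apply/esym]; apply: H.
move=> hi hj /esym/eqP; rewrite eqn_mod_dvd ?leq_mul2l ?le ?orbT //.
rewrite -mulnBr Gauss_dvdr 1?coprime_sym // => dv.
have /(dvdn_leq _) := dv; case: (ltnP i j) => ij; last by move=> _; lia.
by rewrite subn_gt0 ij => /(_ isT); lia.
Qed.

(** All exponents in [tau g i] are congruent to [n i] modulo [d], and these classes are distinct for
    [i < d] by coprimality. So the terms of [phi g] have disjoint supports and nothing cancels. *)
Lemma coef_weight_poly g i N : (size g <= d)%N -> (i < d)%N -> (tau g i)`_N != 0 ->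
  (phi g)`_N = (tau g i)`_N.
Proof.
move=> sg hi nz; rewrite (weight_poly_sum sg) coef_sum (bigD1 (Ordinal hi)) //=.
rewrite big1 ?addr0 // => j ji; apply/eqP; apply: contraNT ji => /weight_term_mod E.
by apply/eqP/val_inj/(coprime_mod_inj (ltn_ord j) hi); rewrite -E (weight_term_mod nz).
Qed.

Lemma size_weight_term g i : g`_i != 0 -> size (tau g i) = (d * (size g`_i).-1 + n * i).+1.
Proof.
move=> nz; have sX : (1 < size ('X^d : {poly K}))%N by rewrite size_polyXn.
rewrite /tau size_mulXn ?comp_poly_eq0 // (polySpred (_ : _ \Po _ != 0)) ?comp_poly_eq0 //.
by rewrite size_comp_poly size_polyXn /= addnS addnC [(d * _)%N]mulnC.
Qed.

Lemma weight_term_eq0 g i : g`_i = 0 -> tau g i = 0.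
Proof. by move=> z; rewrite /tau z comp_poly0 mul0r. Qed.

Lemma leq_size_weight_term g i : (size g <= d)%N -> (size (tau g i) <= size (phi g))%N.
Proof.
move=> sg; case: (eqVneq (tau g i) 0) => [->|nz]; first by rewrite size_poly0.
have gi : g`_i != 0 by apply: contra_neq nz => /weight_term_eq0.
have hi : (i < d)%N.
  by rewrite ltnNge; apply: contra_neqN gi => le; rewrite nth_default // (leq_trans sg).
have lc : (tau g i)`_(size (tau g i)).-1 != 0 by rewrite -lead_coefE lead_coef_eq0.
have := lc; rewrite -(coef_weight_poly sg hi lc) => nz'.
rewrite -(prednK (n := size (tau g i))) ?size_poly_gt0 // ltnNge.
by apply: contra_neqN nz' => le; rewrite nth_default.
Qed.

Lemma weight_poly_neq0 g : (size g <= d)%N -> g != 0 -> phi g != 0.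
Proof.
move=> sg g0; have gi : g`_(size g).-1 != 0 by rewrite -lead_coefE lead_coef_eq0.
by rewrite -size_poly_gt0; apply: leq_trans (leq_size_weight_term (size g).-1 sg); rewrite size_weight_term.
Qed.

Lemma weight_poly_lead g : (size g <= d)%N -> g != 0 ->
  exists i : 'I_d, g`_i != 0 /\ size (phi g) = size (tau g i).
Proof.
move=> sg g0; have p0 := weight_poly_neq0 sg g0.
have : (phi g)`_(size (phi g)).-1 != 0 by rewrite -lead_coefE lead_coef_eq0.
rewrite {1}(weight_poly_sum sg) coef_sum.
have [i nz|/(_ _)/eqP H] := pickP (fun i : 'I_d => (tau g i)`_(size (phi g)).-1 != 0).
  move=> _; exists i; split.
    by apply: contra_neq nz => /weight_term_eq0->; rewrite coef0.
  apply/eqP; rewrite eqn_leq leq_size_weight_term // andbT.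
  rewrite -(prednK (n := size (phi g))) ?size_poly_gt0 // ltnNge.
  by apply: contra_neqN nz => le; rewrite nth_default.
by rewrite big1 ?eqxx // => i _; have := H i; rewrite eqbF_neg negbK => /eqP.
Qed.

Lemma size_weight_polyC q : q != 0 -> size (phi q%:P) = (d * (size q).-1).+1.
Proof.
move=> q0; have sX : (1 < size ('X^d : {poly K}))%N by rewrite size_polyXn.
by rewrite weight_polyC polySpred ?comp_poly_eq0 // size_comp_poly size_polyXn mulnC.
Qed.

Lemma weight_termM g h i : tau (g * h) i = \sum_(j < i.+1) tau g j * tau h (i - j).
Proof.
rewrite /tau coefM linear_sum mulr_suml; apply: eq_bigr => j _.
by rewrite rmorphM mulrACA -exprD -mulnDr subnKC // -ltnS.
Qed.

Lemma size_sum_leq (I : finType) (F : I -> {poly K}) m :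
  (forall i, size (F i) <= m)%N -> (size (\sum_i F i)%R <= m)%N.
Proof.
by move=> H; apply: leq_trans (size_sum _ _ _) _; apply/bigmax_leqP => i _.
Qed.

Variable f : {poly K}.
Hypotheses (szf : size f = n.+1) (f_monic : f \is monic).

(* Uses [y^d = f(x)] to lower the degree in [y]. *)
Definition reduce g := take_poly d g + f%:P * drop_poly d g.

Lemma size_reduce g : (size g <= d + d)%N -> (size (reduce g) <= d)%N.
Proof.
move=> sg; apply: leq_trans (size_polyD _ _) _; rewrite geq_max size_take_poly /=.
rewrite mul_polyC; apply: leq_trans (size_scale_leq _ _) _.
by move: sg; clear; rewrite size_drop_poly leq_subLR.
Qed.

(** The pole order is multiplicative: reduction replaces [y^d], of image [t^(n d)], by [f(t^d)], and
    since [f] is monic of degree [n] their difference has degree below [n d] and only affects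
    lower-order terms. *)
Lemma size_weight_poly_reduceM g h : (size g <= d)%N -> (size h <= d)%N -> g != 0 -> h != 0 ->
  size (phi (reduce (g * h))) = size (phi g * phi h).
Proof.
move=> sg sh g0 h0; set p := g * h; rewrite -weight_polyM -/p.
have pg := weight_poly_neq0 sg g0; have ph := weight_poly_neq0 sh h0.
set W := size (phi p).
have EW : W = (size (phi g) + size (phi h)).-1 by rewrite /W weight_polyM size_mul.
have W0 : (0 < W)%N.
  by rewrite EW; move: pg ph; rewrite -!size_poly_gt0; lia.
have lt_tau i : (size (tau p i) <= W)%N.
  rewrite weight_termM; apply: size_sum_leq => j; apply: leq_trans (size_polyMleq _ _) _.
  by rewrite EW; have := leq_size_weight_term j sg; have := leq_size_weight_term (i - j) sh; lia.
have Ep : phi p = phi (take_poly d p) + phi (drop_poly d p) * 'X^(n * d).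
  by rewrite -{1}(poly_take_drop d p) weight_polyD weight_polyM weight_polyXn.
(* The part of [p] of degree at least [d] in [y] is a sum of terms [tau p i], each already bounded
   by [W]. *)
have lt_drop : (size (phi (drop_poly d p) * 'X^(n * d))%R <= W)%N.
  rewrite (weight_poly_sum (leqnn _)) mulr_suml; apply: size_sum_leq => i.
  suff -> : tau (drop_poly d p) i * 'X^(n * d) = tau p (i + d) by [].
  by rewrite /tau coef_drop_poly -mulrA -exprD mulnDr.
have -> : phi (reduce p) = phi p + phi (drop_poly d p) * (f \Po 'X^d - 'X^(n * d)).
  by rewrite Ep /reduce weight_polyD weight_polyM weight_polyC; ring.
case: (eqVneq (phi (drop_poly d p)) 0) => [->|D0]; first by rewrite mul0r addr0.
rewrite size_polyDl //; apply: leq_ltn_trans (size_polyMleq _ _) _.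
move: lt_drop; rewrite size_mulXn // -/W => lt_drop.
suff : (size (f \Po 'X^d - 'X^(n * d))%R <= n * d)%N.
  by move: D0; rewrite -size_poly_gt0; lia.
apply/leq_sizeP => j; rewrite leq_eqVlt => /predU1P[<-|lt]; rewrite coefB coefXn.
  rewrite eqxx coef_comp_poly_Xn // dvdn_mull // mulnK //.
  by move/monicP: f_monic; rewrite lead_coefE szf /= => ->; rewrite subrr.
rewrite gtn_eqF // subr0 coef_comp_poly_Xn //; case: ifP => // dv.
by rewrite nth_default // szf ltn_divRL.
Qed.

End Weight.

(* [iota] sends a polynomial in [y] over [K[x]] to its class in the function
   field; [L] is only a ring with inverses because [funfield] is. *)
Record superelliptic (K : fieldType) (n d : nat) (f : {poly K}) (L : comUnitRingType)
    (iota : {rmorphism {poly {poly K}} -> L}) : Prop := Superelliptic {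
  se_d_gt0 : (0 < d)%N;
  se_coprime : coprime n d;
  se_size : size f = n.+1;
  se_monic : f \is monic;
  se_unit : forall u : L, u != 0 -> u \is a GRing.unit;
  se_frac : forall h : L, exists (g : {poly {poly K}}) (q : {poly K}),
    [/\ q != 0, (size g <= d)%N & h * iota q%:P = iota g];
  se_inj : forall g : {poly {poly K}}, (size g <= d)%N -> iota g = 0 -> g = 0;
  se_rel : iota 'X^d = iota f%:P }.

Section Infinity.
Variables (K : fieldType) (n d : nat) (f : {poly K}) (L : comUnitRingType).
Variable iota : {rmorphism {poly {poly K}} -> L}.
Hypothesis se : superelliptic n d f iota.
Implicit Types (g : {poly {poly K}}) (p q : {poly K}).

Let d_gt0 := se_d_gt0 se.
Let co_nd := se_coprime se.
Let L_unit := se_unit se.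
Local Notation phi := (weight_poly n d).
Local Notation tau := (weight_term n d).

Definition const_embed : {rmorphism K -> L} := iota \o polyC \o polyC.
Local Notation cst := const_embed.

Lemma iota_eq0 g : (size g <= d)%N -> (iota g == 0) = (g == 0).
Proof.
move=> sg; apply/eqP/eqP => [/(se_inj se)|->]; [exact | exact: rmorph0].
Qed.

Lemma iotaC_neq0 q : q != 0 -> iota q%:P != 0.
Proof.
move=> q0; rewrite iota_eq0 ?polyC_eq0 //.
by apply: leq_trans (size_polyC_leq1 _) _.
Qed.

Lemma iota_reduce g : iota (reduce d f g) = iota g.
Proof.
rewrite /reduce -{3}(poly_take_drop d g) !(rmorphD iota) !(rmorphM iota) /=.
by rewrite (se_rel se) mulrC.
Qed.

Lemma iota_sum m g : (size g <= m)%N ->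
  iota g = \sum_(i < m) iota (g`_i)%:P * iota 'X ^+ i.
Proof.
move=> sg; have Eg : g = \poly_(i < m) g`_i.
  apply/polyP => i; rewrite coef_poly; case: ltnP => // le.
  by rewrite nth_default // (leq_trans sg).
rewrite {1}Eg poly_def rmorph_sum; apply: eq_bigr => i _.
by rewrite -mul_polyC rmorphM rmorphXn.
Qed.

Lemma iotaC_sum m q : (size q <= m)%N ->
  iota q%:P = \sum_(i < m) cst q`_i * iota 'X%:P ^+ i.
Proof.
move=> sq; have Eq : q = \poly_(i < m) q`_i.
  apply/polyP => i; rewrite coef_poly; case: ltnP => // le.
  by rewrite nth_default // (leq_trans sq).
rewrite {1}Eq poly_def !rmorph_sum; apply: eq_bigr => i _.
by rewrite -mul_polyC !rmorphM !rmorphXn.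
Qed.

Lemma iotaX_neq0 : iota 'X != 0.
Proof.
have : iota 'X^d != 0.
  rewrite (se_rel se) iotaC_neq0 // -size_poly_eq0 (se_size se) //.
by apply: contraNneq => X0; rewrite rmorphXn /= X0 expr0n eqn0Ngt d_gt0.
Qed.

Section Unique.
Variable v : L -> int.
Hypotheses (valv : valuation cst v) (v_inf : v (iota 'X%:P) < 0).

(** Since [x] has a pole, the leading monomial of [q] has strictly the smallest value. *)
Lemma val_inf_C q : q != 0 -> v (iota q%:P) = v (iota 'X%:P) *+ (size q).-1.
Proof.
move=> q0; have X0 : iota 'X%:P != 0 by rewrite iotaC_neq0 ?polyX_eq0.
pose F (i : 'I_(size q)) := cst q`_i * iota 'X%:P ^+ i.
have vF i : q`_i != 0 -> v (cst q`_i * iota 'X%:P ^+ i) = v (iota 'X%:P) *+ i.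
  move=> qi; rewrite (valM valv) ?cst_neq0 ?(expL_neq0 L_unit) //.
  by rewrite (valC valv) // add0r (valX L_unit valv).
have lt : ((size q).-1 < size q)%N by rewrite prednK ?size_poly_gt0.
pose i0 := Ordinal lt.
have q_i0 : q`_i0 != 0 by rewrite /= -lead_coefE lead_coef_eq0.
have [|i ii0|_ E] := @val_dominant_sum _ _ cst v valv _ F i0.
- by rewrite /F (mulL_neq0 L_unit) ?cst_neq0 ?(expL_neq0 L_unit).
- rewrite /vge /F; case: (eqVneq q`_i 0) => [->|qi]; first by rewrite rmorph0 mul0r eqxx.
  rewrite !vF //; apply/orP; right.
  rewrite !mulrn_int ltz_nmul // ltn_neqAle.
  by rewrite (_ : (i != i0 :> nat) = true) //= -ltnS prednK ?size_poly_gt0.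
by rewrite (iotaC_sum (leqnn _)) [LHS]E /F vF.
Qed.

(** From [y^d = f(x)] and coprimality, [v x = - e d] and [v y = - e n] for some [e > 0]. The nonzero
    terms [g_i(x) y^i] then have distinct values, so [v] is [- e] times the degree of [phi g], and
    [e = 1] because [v] attains 1. *)
Lemma val_inf g : (size g <= d)%N -> g != 0 ->
  v (iota g) = - (size (phi g)).-1%:Z.
Proof.
have X0 : iota 'X%:P != 0 by rewrite iotaC_neq0 ?polyX_eq0.
have f0 : f != 0 by rewrite -size_poly_eq0 (se_size se).
have Y0 := iotaX_neq0.
have E1 : v (iota 'X) *+ d = v (iota 'X%:P) *+ n.
  rewrite -(valX L_unit valv) // -rmorphXn /= (se_rel se) val_inf_C //.
  by rewrite (se_size se).
have [e [e0 Ex Ey]] : exists e : int, [/\ 0 < e, v (iota 'X%:P) = - (e * d%:Z)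
    & v (iota 'X) = - (e * n%:Z)].
  move: E1; rewrite !mulrn_int => E1.
  have : (d%:Z %| n%:Z * v (iota 'X%:P))%Z.
    by apply/dvdzP; exists (v (iota 'X)); rewrite E1 mulrC.
  rewrite Gauss_dvdzr; last by rewrite /coprimez /gcdz /= eqz_nat gcdnC.
  case/dvdzP => e Ee; exists (- e); have [le Ey] := pole_order_split d_gt0 v_inf E1 Ee.
  by split=> //; rewrite Ee; lia.
have key g' : (size g' <= d)%N -> g' != 0 -> v (iota g') = - (e * (size (phi g')).-1%:Z).
  move=> sg g0; have [i [gi Ei]] := weight_poly_lead d_gt0 co_nd sg g0.
  pose F (i : 'I_d) := iota (g'`_i)%:P * iota 'X ^+ i.
  have vF j : g'`_j != 0 ->
      v (iota (g'`_j)%:P * iota 'X ^+ j) = - (e * (size (tau g' j)).-1%:Z).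
    move=> gj; rewrite (valM valv) ?iotaC_neq0 ?(expL_neq0 L_unit) //.
    rewrite val_inf_C // (valX L_unit valv) // Ex Ey size_weight_term //=.
    by rewrite !mulrn_int; lia.
  have [|j ji|_ E] := @val_dominant_sum _ _ cst v valv _ F i.
  - by rewrite /F (mulL_neq0 L_unit) ?iotaC_neq0 ?(expL_neq0 L_unit).
  - rewrite /vge /F; case: (eqVneq g'`_j 0) => [->|gj].
      by rewrite polyC0 rmorph0 mul0r eqxx.
    rewrite !vF //; apply/orP; right.
    have le := leq_size_weight_term d_gt0 co_nd j sg.
    have ne : size (tau g' i) <> size (tau g' j).
      rewrite !size_weight_term // => -[] Eij; case/eqP: ji; apply/val_inj.
      apply: (coprime_mod_inj d_gt0 co_nd (ltn_ord j) (ltn_ord i)).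
      have modE A k : (d * A + n * k = n * k %[mod d])%N by rewrite mulnC modnMDl.
      by rewrite -(modE (size g'`_j).-1 j) -Eij modE.
    have t1 : (0 < size (tau g' i))%N by rewrite size_weight_term.
    have t2 : (0 < size (tau g' j))%N by rewrite size_weight_term.
    rewrite -!mulNr ltz_nmul ?oppr_lt0 //; move: le ne t1 t2; rewrite Ei; clear; lia.
  by rewrite (iota_sum sg) [LHS]E /F vF // Ei.
have [_ _ _ [t [t0 t1]]] := valv.
have [gt [qt [qt0 sgt Et]]] := se_frac se t.
have gt0 : gt != 0.
  apply: contra_eq_neq Et => ->; rewrite rmorph0 (mulL_neq0 L_unit) //.
  exact: iotaC_neq0.
have : v (t * iota qt%:P) = v (iota gt) by rewrite Et.
rewrite (valM valv) ?iotaC_neq0 // t1 (val_inf_C qt0) Ex key // !mulrn_int => E.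
have e1 : e = 1.
  apply: (int_dvd1 (b := d%:Z * (size qt).-1%:Z - (size (phi gt)).-1%:Z)) => //.
  by move: E => /(canRL (addrK _)) ->; ring.
by move=> sg g0; rewrite key // e1 mul1r.
Qed.

End Unique.

(* The valuation at infinity of [h] is [k]; the representation [h = g / q] is not
   unique, hence a relation. *)
Definition pole_rel (h : L) (k : int) : Prop := exists g q,
  [/\ q != 0, (size g <= d)%N, h * iota q%:P = iota g
    & k = (d * (size q).-1)%:Z - (size (phi g)).-1%:Z].

Lemma size_mulC g q : (size g <= d)%N -> (size (g * q%:P)%R <= d)%N.
Proof. by move=> sg; rewrite mulrC mul_polyC; apply: leq_trans (size_scale_leq _ _) sg. Qed.

Lemma size_weight_polyMC g q : (size g <= d)%N -> g != 0 -> q != 0 ->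
  (size (phi (g * q%:P))).-1 = ((size (phi g)).-1 + d * (size q).-1)%N.
Proof.
move=> sg g0 q0; have p0 := weight_poly_neq0 d_gt0 co_nd sg g0.
have sq := size_weight_polyC n d_gt0 q0.
have q0' : phi q%:P != 0 by rewrite -size_poly_eq0 sq.
rewrite weight_polyM size_mul // sq; move: p0; rewrite -size_poly_gt0.
by case: (size _) => // a _ /=; rewrite addnS.
Qed.

Lemma pole_rel_neq0 h g q : h != 0 -> q != 0 -> h * iota q%:P = iota g -> g != 0.
Proof.
move=> h0 q0 E; apply: contra_eq_neq E => ->.
by rewrite rmorph0 (mulL_neq0 L_unit) // iotaC_neq0.
Qed.

Lemma pole_rel_uniq h k k' : h != 0 -> pole_rel h k -> pole_rel h k' -> k = k'.
Proof.
move=> h0 [g [q [q0 sg E ->]]] [g' [q' [q0' sg' E' ->]]].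
have g0 := pole_rel_neq0 h0 q0 E; have g0' := pole_rel_neq0 h0 q0' E'.
have : g * q'%:P = g' * q%:P.
  apply/eqP; rewrite -subr_eq0 -iota_eq0; last first.
    by apply: leq_trans (size_polyD _ _) _; rewrite geq_max size_polyN !size_mulC.
  by rewrite rmorphB !rmorphM /= -E -E' mulrAC subrr.
move/(congr1 (fun r : {poly {poly K}} => (size (phi r)).-1)); rewrite !size_weight_polyMC //.
lia.
Qed.

Lemma pole_relM h h' k k' : h != 0 -> h' != 0 ->
  pole_rel h k -> pole_rel h' k' -> pole_rel (h * h') (k + k').
Proof.
move=> h0 h0' [g [q [q0 sg E ->]]] [g' [q' [q0' sg' E' ->]]].
have g0 := pole_rel_neq0 h0 q0 E; have g0' := pole_rel_neq0 h0' q0' E'.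
exists (reduce d f (g * g')), (q * q'); split.
- by rewrite mulf_neq0.
- apply: size_reduce; apply: leq_trans (size_polyMleq _ _) _.
  by move: sg sg'; clear; lia.
- by rewrite iota_reduce polyCM !rmorphM /= -E -E'; ring.
rewrite (size_weight_poly_reduceM d_gt0 co_nd (se_size se) (se_monic se)) //.
have := weight_poly_neq0 d_gt0 co_nd sg g0; have := weight_poly_neq0 d_gt0 co_nd sg' g0'.
move=> p0' p0; rewrite !size_mul //; move: p0 p0'; rewrite -!size_poly_gt0.
have -> : (size q + size q').-1.-1 = ((size q).-1 + (size q').-1)%N.
  by move: q0 q0'; rewrite -!size_poly_gt0; clear; lia.
rewrite mulnDr; clear; move: (size (phi g)) (size (phi g')) => s1 s2.
by move: (d * _)%N (d * _)%N => x y; lia.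
Qed.

Lemma pole_relD h h' k k' : h != 0 -> h' != 0 -> h + h' != 0 ->
  pole_rel h k -> pole_rel h' k' ->
  exists2 l, pole_rel (h + h') l & Num.min k k' <= l.
Proof.
move=> h0 h0' hh0 [g [q [q0 sg E ->]]] [g' [q' [q0' sg' E' ->]]].
have g0 := pole_rel_neq0 h0 q0 E; have g0' := pole_rel_neq0 h0' q0' E'.
pose G := g * q'%:P + g' * q%:P.
have sG : (size G <= d)%N.
  by apply: leq_trans (size_polyD _ _) _; rewrite geq_max !size_mulC.
have EG : (h + h') * iota (q * q')%:P = iota G.
  by rewrite /G polyCM rmorphD !rmorphM /= -E -E'; ring.
have qq0 : q * q' != 0 by rewrite mulf_neq0.
eexists; first by exists G, (q * q').
have G0 := pole_rel_neq0 hh0 qq0 EG.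
have le := size_polyD (phi (g * q'%:P)) (phi (g' * q%:P)).
rewrite -weight_polyD -/G in le.
have := size_weight_polyMC sg g0 q0'; have := size_weight_polyMC sg' g0' q0.
have := weight_poly_neq0 d_gt0 co_nd sG G0.
have := weight_poly_neq0 d_gt0 co_nd (size_mulC q' sg) (mulf_neq0 g0 (_ : q'%:P != 0)).
have := weight_poly_neq0 d_gt0 co_nd (size_mulC q sg') (mulf_neq0 g0' (_ : q%:P != 0)).
rewrite !polyC_eq0 => /(_ q0) + /(_ q0') +.
rewrite -!size_poly_gt0 size_mul //.
have -> : (size q + size q').-1.-1 = ((size q).-1 + (size q').-1)%N.
  by move: q0 q0'; rewrite -!size_poly_gt0; clear; lia.
move: le; rewrite mulnDr; clear.
move: (size (phi G)) (size (phi (g * _))) (size (phi (g' * _))) => s1 s2 s3.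
by move: (d * _)%N (d * _)%N (size (phi g)) (size (phi g')) => x y z t; lia.
Qed.

Lemma inf_valuation_exists : exists v, valuation cst v /\ v (iota 'X%:P) < 0.
Proof.
pose v h := epsilon (inhabits (0 : int)) (pole_rel h).
have vP h : pole_rel h (v h).
  apply: epsilon_spec; have [g [q [q0 sg E]]] := se_frac se h.
  by eexists; exists g, q.
have vE h k : h != 0 -> pole_rel h k -> v h = k.
  by move=> h0; apply: pole_rel_uniq.
have rP g q : q != 0 -> g != 0 -> (size g <= d)%N -> forall h, h * iota q%:P = iota g ->
    v h = (d * (size q).-1)%:Z - (size (phi g)).-1%:Z.
  move=> q0 g0 sg h E; apply: vE; last by exists g, q.
  by apply: contraNneq g0 => h0; rewrite -iota_eq0 // -E h0 mul0r.
have vC p : p != 0 -> v (iota p%:P) = - (d * (size p).-1)%:Z.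
  move=> p0; rewrite (rP p%:P 1) ?oner_neq0 ?polyC_eq0 ?size_poly1 ?polyC1 ?rmorph1 ?mulr1 //.
    by rewrite size_weight_polyC // muln0 sub0r.
  exact: leq_trans (size_polyC_leq1 _) _.
exists v; split; last by rewrite vC ?polyX_eq0 // size_polyX; move: d_gt0; clear; lia.
have vM (g h : L) : g != 0 -> h != 0 -> v (g * h) = v g + v h.
  by move=> g0 h0; apply: vE; [exact: mulL_neq0 | exact: pole_relM].
split=> //.
- move=> g h g0 h0 gh0; have [l /(vE _ _ gh0) -> //] := pole_relD g0 h0 gh0 (vP g) (vP h).
- by move=> c c0; rewrite /= vC ?polyC_eq0 // size_polyC c0 muln0.
have vX (g : L) k : g != 0 -> v (g ^+ k) = v g *+ k.
  move=> g0; elim: k => [|k IH].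
    by rewrite expr0 -(rmorph1 iota) -polyC1 vC ?oner_eq0 // size_poly1 muln0.
  by rewrite exprS vM ?expL_neq0 // IH mulrS.
have f0 : f != 0 by rewrite -size_poly_eq0 (se_size se).
have Y0 := iotaX_neq0; have X0 : iota 'X%:P != 0 by rewrite iotaC_neq0 ?polyX_eq0.
(* Bezout gives [a d = b n + 1], so that [y^b / x^a] has value [a d - b n = 1]. *)
have [a b E _] := egcdnP n d_gt0; rewrite gcdnC (eqP co_nd) in E.
have xa0 := expL_neq0 L_unit a X0; have yb0 := expL_neq0 L_unit b Y0.
pose t := iota 'X ^+ b / iota 'X%:P ^+ a.
have Et : t * iota 'X%:P ^+ a = iota 'X ^+ b by rewrite /t divrK ?L_unit.
have t0 : t != 0 by apply: contraNneq yb0 => t0; rewrite -Et t0 mul0r.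
exists t; split=> //; have : v (t * iota 'X%:P ^+ a) = v (iota 'X ^+ b) by rewrite Et.
have : v (iota 'X) *+ d = - (d * n)%:Z.
  by rewrite -vX // -rmorphXn /= (se_rel se) vC // (se_size se).
rewrite vM // !vX // vC ?polyX_eq0 // size_polyX !mulrn_int.
move=> Ey; have -> : v (iota 'X) = - n%:Z.
  have dz : d%:Z != 0 by rewrite eqz_nat -lt0n.
  by apply: (mulIf dz); rewrite Ey PoszM; ring.
have : (a * d)%:Z = (b * n + 1)%:Z by rewrite E.
rewrite PoszD !PoszM => Eab /(canRL (addrK _)) ->.
by rewrite mulr1 !mulNr opprK [d%:Z * _]mulrC Eab; ring.
Qed.

End Infinity.

(** * Affine places *)

Section Affine.
Variables (K : fieldType) (n d : nat) (f : {poly K}) (L : comUnitRingType).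
Variable iota : {rmorphism {poly {poly K}} -> L}.
Hypothesis se : superelliptic n d f iota.
Hypotheses (d_gt1 : (1 < d)%N) (dK : d%:R != 0 :> K).
Variables (a b : K).
Hypotheses (on_curve : b ^+ d = f.[a]).
Hypothesis smooth : b = 0 -> exists2 q, f = ('X - a%:P) * q & q.[a] != 0.
Implicit Types (g u w : {poly {poly K}}) (p q : {poly K}).

Let d_gt0 := se_d_gt0 se.
Let L_unit := se_unit se.
Local Notation cst := (const_embed iota).

Definition eval2 g : K := g.[b%:P].[a].
Local Notation ev := eval2.

Lemma eval2M u w : ev (u * w) = ev u * ev w.
Proof. by rewrite /ev !hornerM. Qed.

Lemma eval2D u w : ev (u + w) = ev u + ev w.
Proof. by rewrite /ev !hornerD. Qed.

Lemma eval2C q : ev q%:P = q.[a].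
Proof. by rewrite /ev hornerC. Qed.

Lemma eval2X : ev 'X = b.
Proof. by rewrite /ev hornerX hornerC. Qed.

Lemma eval2Xn u k : ev (u ^+ k) = ev u ^+ k.
Proof. by rewrite /ev !horner_exp. Qed.

Lemma eval2_0 : ev 0 = 0.
Proof. by rewrite /ev !horner0. Qed.

Lemma eval2_1 : ev 1 = 1.
Proof. by rewrite -polyC1 eval2C hornerC. Qed.

(** The kernel of [iota] consists of multiples of [Y^d - f], which vanish at [(a, b)]; hence
    evaluation at the point is well defined on the image of [iota]. *)
Lemma iota_eval2 u w : iota u = iota w -> ev u = ev w.
Proof.
move=> E; apply/eqP; rewrite -subr_eq0; apply/eqP.
have -> : ev u - ev w = ev (u - w) by rewrite /ev !hornerE.
have : iota (u - w) = 0 by rewrite rmorphB E subrr.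
move: (u - w) => g; pose D : {poly {poly K}} := 'X^d - f%:P.
have mD : D \is monic by rewrite monicXnsubC.
have D0 : D != 0 by rewrite monic_neq0.
have iD : iota D = 0 by rewrite /D rmorphB /= (se_rel se) subrr.
have eD : ev D = 0.
  by rewrite /D -polyCN eval2D eval2Xn eval2X eval2C hornerN on_curve subrr.
rewrite (Pdiv.RingMonic.rdivp_eq mD g) rmorphD rmorphM /= iD mulr0 add0r => r0.
rewrite eval2D eval2M eD mulr0 add0r (se_inj se _ r0) ?eval2_0 //.
by have := Pdiv.Ring.ltn_rmodp g D; rewrite D0 size_XnsubC.
Qed.

Lemma iota_eval2_neq0 u : ev u != 0 -> iota u != 0.
Proof.
by apply: contraNneq => u0; rewrite -eval2_0; apply/eqP/iota_eval2; rewrite u0 rmorph0.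
Qed.

(** The point is ramified over the [x]-line iff [b = 0]; there [x - a] vanishes to order [d] and [y]
    is the local parameter. *)
Definition uniformizer : {poly {poly K}} := if b == 0 then 'X else ('X - a%:P)%:P.
Local Notation t := uniformizer.

Lemma eval2_uniformizer : ev t = 0.
Proof.
by rewrite /t; case: (b =P 0) => [b0|_]; rewrite ?eval2X // eval2C !hornerE subrr.
Qed.

Lemma iota_y_neq0 : iota 'X != 0.
Proof. by rewrite (iota_eq0 se) ?polyX_eq0 // size_polyX. Qed.

Lemma iota_uniformizer : iota t != 0.
Proof.
rewrite /t; case: (b =P 0) => _; first exact: iota_y_neq0.
by rewrite (iotaC_neq0 se) // polyXsubC_eq0.
Qed.

Lemma poly_root_factor p : p.[a] = 0 -> exists q, p = ('X - a%:P) * q.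
Proof. by move/rootP/factor_theorem => [q ->]; exists q; rewrite mulrC. Qed.

Lemma eval2_eq0_split u : ev u = 0 ->
  exists s r, u = s * ('X - b%:P%:P) + (('X - a%:P) * r)%:P.
Proof.
move=> u0; have /factor_theorem [s Es] : root (u - u.[b%:P]%:P) b%:P.
  by rewrite /root !hornerE subrr.
have [r Er] := poly_root_factor u0.
by exists s, r; rewrite -Er -Es subrK.
Qed.

(** The cofactor of [y - u] in [y^d - u^d]; for [u] in [K[x]] it is, up to sign, the norm of [y - u]
    to [K(x)] divided by [y - u]. *)
Definition conj_sum u : {poly {poly K}} := \sum_(i < d) 'X^(d.-1 - i) * u ^+ i.

Lemma conj_sumE u : ('X - u) * conj_sum u = 'X^d - u ^+ d.
Proof. by rewrite /conj_sum -subrXX. Qed.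

Lemma eval2_conj_sum u : b != 0 -> ev u = b -> ev (conj_sum u) != 0.
Proof.
move=> b0 ub; suff -> : ev (conj_sum u) = d%:R * b ^+ d.-1.
  by rewrite mulf_neq0 ?expf_neq0.
rewrite {1}/eval2 /conj_sum !horner_sum (eq_bigr (fun=> b ^+ d.-1)) => [|i _].
  by rewrite sumr_const card_ord mulr_natl.
rewrite -[LHS]/(ev _) eval2M !eval2Xn eval2X ub -exprD subnK //.
by rewrite -ltnS prednK.
Qed.

(** The maximal ideal of the point is generated by [y - b] and [x - a], and both are multiples of
    [t] up to a factor [w] not vanishing there. If [b = 0], then [(x - a) q = y^d] with [q(a) <> 0];
    otherwise [(y - b) S = f - b^d] is divisible by [x - a], and [S] takes the value [d b^(d-1)]. *)
Lemma eval2_eq0_factor u : ev u = 0 ->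
  exists u' w, ev w != 0 /\ iota (u * w) = iota (t * u').
Proof.
move/eval2_eq0_split => [s [r ->]]; rewrite /t; case: (b =P 0) => [b0|/eqP b0].
  have [q Eq qa] := smooth b0.
  exists (s * q%:P + 'X^(d.-1) * r%:P), q%:P; rewrite eval2C; split=> //.
  rewrite b0 !polyC0 subr0 mulrDr [_ * q%:P]mulrDl !(rmorphD iota); congr (_ + _).
    by congr (iota _); ring.
  have -> : (('X - a%:P) * r)%:P * q%:P = f%:P * r%:P.
    by rewrite Eq -!polyCM; congr _%:P; ring.
  by rewrite mulrA -exprS prednK // !(rmorphM iota) (se_rel se).
have [q Eq] : exists q, f - (b ^+ d)%:P = ('X - a%:P) * q.
  by apply: poly_root_factor; rewrite !hornerE on_curve subrr.
pose S := conj_sum b%:P%:P.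
exists (s * q%:P + r%:P * S), S; split.
  by apply: eval2_conj_sum; rewrite // eval2C hornerC.
have -> : (s * ('X - b%:P%:P) + (('X - a%:P) * r)%:P) * S =
  s * (('X - b%:P%:P) * S) + ('X - a%:P)%:P * r%:P * S.
  by rewrite polyCM; ring.
rewrite conj_sumE -!polyC_exp !(rmorphD iota) !(rmorphM iota) (rmorphB iota) (se_rel se).
rewrite -(rmorphB iota) -polyCB Eq polyCM !(rmorphD iota) !(rmorphM iota).
by ring.
Qed.

Lemma x_sub_uniformizer : exists e u w,
  [/\ ev u != 0, ev w != 0 & iota ('X - a%:P)%:P * iota w = iota t ^+ e * iota u].
Proof.
rewrite /t; case: (b =P 0) => [b0|/eqP b0].
  have [q Eq qa] := smooth b0.
  exists d, 1, q%:P; rewrite eval2_1 oner_neq0 eval2C; split; [by [] | exact: qa |].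
  by rewrite -(rmorphM iota) -polyCM -Eq -(se_rel se) (rmorphXn iota) (rmorph1 iota) mulr1.
by exists 1%N, 1, 1; rewrite eval2_1 oner_neq0 expr1.
Qed.

Lemma uniformizer_expI k k' u u' : ev u != 0 -> ev u' != 0 ->
  iota t ^+ k * iota u = iota t ^+ k' * iota u' -> k = k'.
Proof.
wlog le : k k' u u' / (k <= k')%N.
  move=> H u0 u0' E; case: (leqP k k') => [le|/ltnW le]; first exact: H le u0 u0' E.
  by apply/esym/(H _ _ _ _ le u0' u0); rewrite E.
move=> u0 u0'; rewrite -(subnKC le) exprD -mulrA.
move/(mulLI L_unit (expL_neq0 L_unit _ iota_uniformizer)).
case: (k' - k)%N => [|m]; first by rewrite addn0.
rewrite -rmorphXn -rmorphM => /iota_eval2.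
by rewrite eval2M eval2Xn eval2_uniformizer expr0n mul0r => E; rewrite E eqxx in u0.
Qed.

(* Peeling off uniformizers stops: multiplying [g] by a numerator of its inverse
   gives a polynomial in [x], whose order of vanishing at [a] bounds that of [g]. *)
Lemma uniformizer_split g : iota g != 0 -> exists k u w,
  [/\ ev u != 0, ev w != 0 & iota g * iota w = iota t ^+ k * iota u].
Proof.
move=> g0; apply: NNPP => nosplit.
have step k : exists u w, ev w != 0 /\ iota g * iota w = iota t ^+ k * iota u.
  elim: k => [|k [u [w [w0 E]]]].
    by exists g, 1; rewrite eval2_1 oner_neq0 rmorph1 mulr1 expr0 mul1r.
  have u0 : ev u = 0.
    by apply/eqP/negPn/negP => u0; case: nosplit; exists k, u, w.
  have [u' [w' [w0' E']]] := eval2_eq0_factor u0.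
  exists u', (w * w'); rewrite eval2M mulf_neq0 //; split=> //.
  by rewrite rmorphM mulrA E -mulrA -rmorphM E' rmorphM exprSr mulrA.
have [h [q [q0 sh Eh]]] := se_frac se (iota g)^-1.
have Egh : iota g * iota h = iota q%:P.
  by rewrite -Eh mulrA divrr ?L_unit // mul1r.
have [e [u1 [w1 [u10 w10 E1]]]] := x_sub_uniformizer.
have [m [q' qa Eq]] := multiplicity_XsubC q a; rewrite q0 /= in qa.
(* [q] has order [m e] at the point, [m] being the multiplicity of its root [a]; one more factor [t]
   than that is extracted from [g], which divides [q]. *)
have [u [w [w0 E]]] := step (m * e).+1.
have qa' : ev q'%:P != 0 by rewrite eval2C.
have : iota t ^+ (m * e) * iota (q'%:P * w * u1 ^+ m) =
       iota t ^+ (m * e).+1 * iota (u * h * w1 ^+ m).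
  transitivity (iota g * iota h * iota w * iota w1 ^+ m); last first.
    rewrite !(rmorphM iota) (rmorphXn iota).
    transitivity ((iota g * iota w) * (iota h * iota w1 ^+ m)); first by ring.
    by rewrite E; ring.
  rewrite Egh Eq polyCM polyC_exp !(rmorphM iota) !(rmorphXn iota).
  transitivity ((iota ('X - a%:P)%:P * iota w1) ^+ m * iota q'%:P * iota w).
    by rewrite E1 exprMn -exprM [(e * m)%N]mulnC; ring.
  by rewrite exprMn; ring.
rewrite exprSr -[RHS]mulrA => /(mulLI L_unit (expL_neq0 L_unit _ iota_uniformizer)).
rewrite -rmorphM => /iota_eval2; rewrite [in RHS]eval2M eval2_uniformizer mul0r => /eqP.
by rewrite !eval2M eval2Xn !mulf_eq0 expf_eq0 (negPf qa') (negPf w0) (negPf u10) andbF.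
Qed.

(** [u] and [w] are local units; powers of [t] stand on both sides because the order [j - i] may be
    negative. *)
Definition order_rel (h : L) (k : int) : Prop := exists i j u w,
  [/\ ev u != 0, ev w != 0, h * iota t ^+ i * iota w = iota t ^+ j * iota u
    & k = j%:Z - i%:Z].

Lemma order_rel_ex h : h != 0 -> exists k, order_rel h k.
Proof.
move=> h0; have [g [q [q0 sg E]]] := se_frac se h.
have iq0 := iotaC_neq0 se q0.
have ig0 : iota g != 0 by rewrite -E mulL_neq0.
have [k [u [w [u0 w0 E1]]]] := uniformizer_split ig0.
have [k' [u' [w' [u0' w0' E1']]]] := uniformizer_split iq0.
exists (k%:Z - k'%:Z), k', k, (u * w'), (u' * w).
rewrite !eval2M !mulf_neq0 //; split=> //.
rewrite !(rmorphM iota).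
transitivity (h * (iota t ^+ k' * iota u') * iota w); first by ring.
rewrite -E1'; transitivity (h * iota q%:P * iota w * iota w'); first by ring.
by rewrite E E1; ring.
Qed.

Lemma order_rel_uniq h k k' : h != 0 -> order_rel h k -> order_rel h k' -> k = k'.
Proof.
move=> h0 [i [j [u [w [u0 w0 E ->]]]]] [i' [j' [u' [w' [u0' w0' E' ->]]]]].
suff : (j + i')%N = (j' + i)%N by lia.
apply: (@uniformizer_expI _ _ (u * w') (u' * w)); rewrite ?eval2M ?mulf_neq0 //.
rewrite !exprD !rmorphM.
transitivity (iota t ^+ j * iota u * (iota t ^+ i' * iota w')); first by ring.
rewrite -E; transitivity (iota t ^+ j' * iota u' * (iota t ^+ i * iota w)); last by ring.
by rewrite -E'; ring.
Qed.

Lemma order_relM h h' k k' : order_rel h k -> order_rel h' k' -> order_rel (h * h') (k + k').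
Proof.
move=> [i [j [u [w [u0 w0 E ->]]]]] [i' [j' [u' [w' [u0' w0' E' ->]]]]].
exists (i + i')%N, (j + j')%N, (u * u'), (w * w'); rewrite !eval2M !mulf_neq0 //.
split=> //; last by lia.
rewrite !exprD !rmorphM.
transitivity ((h * iota t ^+ i * iota w) * (h' * iota t ^+ i' * iota w')); first by ring.
by rewrite E E'; ring.
Qed.

(** Over a common denominator the smaller power [t^c] is factored out of the sum; the cofactor [G]
    may vanish at the point, which can only increase the order. *)
Lemma order_relD h h' k k' : h + h' != 0 ->
  order_rel h k -> order_rel h' k' ->
  exists2 l, order_rel (h + h') l & Num.min k k' <= l.
Proof.
move=> hh0 [i [j [u [w [u0 w0 E ->]]]]] [i' [j' [u' [w' [u0' w0' E' ->]]]]].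
pose c := minn (j + i') (j' + i).
pose G := t ^+ (j + i' - c) * u * w' + t ^+ (j' + i - c) * u' * w.
have EG : (h + h') * iota t ^+ (i + i') * iota (w * w') = iota t ^+ c * iota G.
  rewrite /G rmorphD !rmorphM !rmorphXn mulrDr !mulrA -!exprD !subnKC ?geq_minl ?geq_minr //.
  transitivity ((h * iota t ^+ i * iota w) * iota t ^+ i' * iota w'
     + (h' * iota t ^+ i' * iota w') * iota t ^+ i * iota w).
    by rewrite exprD; ring.
  by rewrite E E' !exprD; ring.
have t0 := iota_uniformizer.
have G0 : iota G != 0.
  apply: contraTneq isT => G0; move/eqP: EG; rewrite G0 mulr0; apply: contraTeq => _.
  rewrite !(mulL_neq0 L_unit) ?(expL_neq0 L_unit) //.
  by rewrite iota_eval2_neq0 // eval2M mulf_neq0.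
have [m [v [z [v0 z0 Ez]]]] := uniformizer_split G0.
exists ((c + m)%N%:Z - (i + i')%N%:Z); last by rewrite /c; clear; lia.
exists (i + i')%N, (c + m)%N, v, (w * w' * z); rewrite !eval2M !mulf_neq0 //; split=> //.
by rewrite rmorphM mulrA EG -mulrA Ez exprD mulrA.
Qed.

Lemma order_rel_unit g : ev g != 0 -> order_rel (iota g) 0.
Proof.
by move=> g0; exists 0%N, 0%N, g, 1; rewrite eval2_1 oner_neq0 !expr0 rmorph1 !mulr1 mul1r.
Qed.

Lemma order_rel_uniformizer : order_rel (iota t) 1.
Proof.
by exists 0%N, 1%N, 1, 1; rewrite eval2_1 oner_neq0 expr0 expr1 rmorph1 !mulr1.
Qed.

Lemma order_rel_gt0 g k : ev g = 0 -> iota g != 0 -> order_rel (iota g) k -> 0 < k.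
Proof.
move=> eg0 g0; have [m [u [w [u0 w0 E]]]] := uniformizer_split g0.
have : order_rel (iota g) m%:Z.
  by exists 0%N, m, u, w; rewrite expr0 mulr1 subr0.
move=> /(order_rel_uniq g0) H /H <-; case: m E {H} => // E.
move: u0; rewrite -(@iota_eval2 (g * w)) ?eval2M ?eg0 ?mul0r ?eqxx //.
by rewrite rmorphM E expr0 mul1r.
Qed.

Lemma affine_valuation_exists : exists v, [/\ valuation cst v,
  0 < v (iota ('X - a%:P)%:P) & 0 < v (iota ('X - b%:P%:P))].
Proof.
pose v h := epsilon (inhabits (0 : int)) (order_rel h).
have vP h : h != 0 -> order_rel h (v h).
  by move=> h0; apply: epsilon_spec; exact: order_rel_ex.
have vE h k : h != 0 -> order_rel h k -> v h = k.
  by move=> h0; apply: order_rel_uniq => //; exact: vP.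
have t0 := iota_uniformizer.
exists v; split; last first.
- apply: (@order_rel_gt0 ('X - b%:P%:P)); last apply: vP.
  + by rewrite -polyCN eval2D eval2X eval2C !hornerE subrr.
  + by rewrite (iota_eq0 se) ?polyXsubC_eq0 // size_XsubC.
  + by rewrite (iota_eq0 se) ?polyXsubC_eq0 // size_XsubC.
- apply: (@order_rel_gt0 ('X - a%:P)%:P); last apply: vP.
  + by rewrite eval2C !hornerE subrr.
  + by rewrite (iotaC_neq0 se) // polyXsubC_eq0.
  + by rewrite (iotaC_neq0 se) // polyXsubC_eq0.
split.
- move=> g h g0 h0; apply: vE; first exact: mulL_neq0.
  by apply: order_relM; apply: vP.
- move=> g h g0 h0 gh0.
  by have [l /(vE _ _ gh0) ->] := order_relD gh0 (vP g g0) (vP h h0).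
- move=> c c0; apply: vE; first exact: cst_neq0.
  by apply: order_rel_unit; rewrite eval2C hornerC.
by exists (iota t); split=> //; apply: vE => //; exact: order_rel_uniformizer.
Qed.

Section Unique.
Variable v : L -> int.
Hypotheses (valv : valuation cst v).
Hypotheses (v_x : 0 < v (iota ('X - a%:P)%:P)) (v_y : 0 < v (iota ('X - b%:P%:P))).

Lemma vgeX (u : L) k : vge v 0 u -> vge v 0 (u ^+ k).
Proof.
move=> u0; elim: k => [|k IH].
  by rewrite expr0 /vge (val1 valv) lexx orbT.
by rewrite exprS -[0](addr0 0); apply: (vgeM valv).
Qed.

Lemma vge_cst c : vge v 0 (cst c).
Proof.
case: (eqVneq c 0) => [->|c0]; first by rewrite rmorph0 vge0.
by rewrite /vge (valC valv) // lexx orbT.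
Qed.

Lemma vgeM0 (u w : L) : vge v 0 u -> vge v 0 w -> vge v 0 (u * w).
Proof. by move=> u0 w0; rewrite -[0](addr0 0); apply: (vgeM valv). Qed.

Lemma vge_iota g : vge v 0 (iota g).
Proof.
have Hx : vge v 0 (iota 'X%:P).
  have -> : iota 'X%:P = iota ('X - a%:P)%:P + cst a.
    by rewrite /= -rmorphD -polyCD subrK.
  by apply: (vgeD valv); [rewrite /vge (ltW v_x) orbT | exact: vge_cst].
have Hy : vge v 0 (iota 'X).
  have -> : iota 'X = iota ('X - b%:P%:P) + cst b by rewrite /= -rmorphD subrK.
  by apply: (vgeD valv); [rewrite /vge (ltW v_y) orbT | exact: vge_cst].
rewrite (iota_sum iota (leqnn _)); apply: (vge_sum valv) => i _.
apply: vgeM0; last exact: vgeX.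
rewrite (iotaC_sum iota (leqnn _)); apply: (vge_sum valv) => j _.
by apply: vgeM0; [exact: vge_cst | exact: vgeX].
Qed.

Lemma val_iota_ge0 g : iota g != 0 -> 0 <= v (iota g).
Proof. by move=> g0; apply: (vgeP g0); exact: vge_iota. Qed.

Lemma vge1_iota g : ev g = 0 -> vge v 1 (iota g).
Proof.
move/eval2_eq0_split => [s [r ->]]; rewrite rmorphD polyCM !rmorphM.
apply: (vgeD valv).
  rewrite -[1](add0r 1); apply: (vgeM valv) => //; first exact: vge_iota.
  by rewrite /vge -[1](add0r 1) lezD1 v_y orbT.
rewrite -[1](addr0 1); apply: (vgeM valv) => //; last exact: vge_iota.
by rewrite /vge -[1](add0r 1) lezD1 v_x orbT.
Qed.

Lemma val_iota_gt0 g : iota g != 0 -> ev g = 0 -> 0 < v (iota g).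
Proof. by move=> g0 /vge1_iota /(vgeP g0); exact: lt_le_trans. Qed.

(** [g] is its nonzero value at the point plus a function of positive value, so the constant
    dominates. *)
Lemma val_iota_eq0 g : ev g != 0 -> v (iota g) = 0.
Proof.
move=> g0; have -> : iota g = cst (ev g) + iota (g - (ev g)%:P%:P).
  by rewrite /= -rmorphD addrC subrK.
have c0 : cst (ev g) != 0 by exact: cst_neq0.
have [|_ ->] := val_dominant valv c0 (w := iota (g - (ev g)%:P%:P)).
  rewrite (valC valv) // add0r; apply: vge1_iota.
  by rewrite -!polyCN eval2D eval2C !hornerE subrr.
exact: valC.
Qed.

(** Every nonzero function is a power of [t] times a quotient of local units, so all values are
    multiples of [v t]; and the value 1 occurs. *)
Lemma val_uniformizer : v (iota t) = 1.
Proof.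
have t0 := iota_uniformizer; have vt := val_iota_gt0 t0 eval2_uniformizer.
have [_ _ _ [z [z0 z1]]] := valv.
have [k [i [j [u [w [u0 w0 E _]]]]]] := order_rel_ex z0.
have : v (z * iota t ^+ i * iota w) = v (iota t ^+ j * iota u) by rewrite E.
have iw0 := iota_eval2_neq0 w0; have iu0 := iota_eval2_neq0 u0.
have te k' := expL_neq0 L_unit k' t0.
rewrite !(valM valv) ?(mulL_neq0 L_unit) // (val_iota_eq0 w0) (val_iota_eq0 u0).
rewrite z1 !(valX L_unit valv) // !mulrn_int !addr0 => Ev.
apply: (int_dvd1 (b := j%:Z - i%:Z)) => //.
by move: Ev => /(canRL (addrK _)) ->; ring.
Qed.

Lemma val_x_sub : b != 0 -> v (iota ('X - a%:P)%:P) = 1.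
Proof. by move=> b0; have := val_uniformizer; rewrite /t (negPf b0). Qed.

End Unique.

End Affine.

(** * The function field *)

Lemma common_denominator (R : idomainType) (p : {poly {fraction R}}) :
  exists (q : R) (g : {poly R}),
    q != 0 /\ p * (FracField.tofrac q)%:P = map_poly (@FracField.tofrac R) g.
Proof.
elim/poly_ind: p => [|p c [q [g [q0 E]]]].
  by exists 1, 0; rewrite oner_neq0 mul0r rmorph0.
have [x [y [y0 Ec]]] := frac_ex c.
exists (q * y), (g * 'X * y%:P + (q * x)%:P); rewrite mulf_neq0 //; split=> //.
rewrite rmorphD !rmorphM /= -E map_polyX !map_polyC /= ?tofracM ?polyCM.
rewrite -Ec !polyCM; move: (_ q)%:P (_ y)%:P c%:P => u w z.
by ring.
Qed.

Lemma tofrac_inj (R : idomainType) : injective (@FracField.tofrac R).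
Proof. by move=> x y /eqP; rewrite tofrac_eq => /eqP. Qed.

Section Model.
Variables (K : fieldType) (n d : nat) (f : {poly K}).
Hypotheses (d_gt1 : (1 < d)%N) (co_nd : coprime n d) (szf : size f = n.+1).
Hypothesis f_monic : f \is monic.

Let d_gt0 : (0 < d)%N. Proof. exact: ltnW. Qed.
Local Notation D := (defining_poly d f).

Definition coord_ring_map : {rmorphism {poly {poly K}} -> funfield d f} :=
  in_qpoly D \o map_poly (@FracField.tofrac {poly K}).
Local Notation iota := coord_ring_map.

(** The ring [{poly %/ p}] is built from [mk_monic p], which falls back to a default polynomial
    unless [p] is monic and nonconstant. *)
Lemma mk_monic_defining : mk_monic D = D.
Proof.
by rewrite /mk_monic size_defining_poly // ltnS d_gt0 defining_poly_monic.
Qed.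

Lemma size_tofrac (g : {poly {poly K}}) : size (map_poly (@FracField.tofrac {poly K}) g) = size g.
Proof. by rewrite size_map_inj_poly ?rmorph0 //; exact: tofrac_inj. Qed.

Lemma coord_ring_superelliptic : superelliptic n d f iota.
Proof.
split=> //.
- exact: (funfield_unit d_gt0 co_nd szf).
- move=> h; have [q [g [q0 E]]] := common_denominator (h : {poly {fraction {poly K}}}).
  exists g, q; split=> //.
    have : (size (polyn h) <= d)%N.
      have := size_mk_monic h; move: (polyn h) => p.
      by rewrite mk_monic_defining size_defining_poly.
    apply: leq_trans; rewrite -size_tofrac -E mulrC mul_polyC.
    exact: size_scale_leq.
  have Eh : h = in_qpoly D (h : {poly {fraction {poly K}}}).
    by apply/val_inj; rewrite /= -[RHS]/(polyn (in_qpoly D h)) in_qpoly_small // size_mk_monic.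
  by rewrite /= -E rmorphM /= -Eh map_polyC.
- move=> g sg /(congr1 (@polyn _ _)) /=; rewrite -[LHS]/(polyn (in_qpoly D _)).
  rewrite in_qpoly_small; last first.
    by rewrite mk_monic_defining size_defining_poly // ltnS size_tofrac.
  move=> E; apply: (map_inj_poly (@tofrac_inj {poly K})); first exact: rmorph0.
  by rewrite rmorph0 E.
apply/eqP; rewrite -subr_eq0 -rmorphB /=; apply/eqP/val_inj => /=.
rewrite rmorphB /= map_polyXn map_polyC mk_monic_defining.
by rewrite Pdiv.RingMonic.rmodpp ?defining_poly_monic.
Qed.

Lemma funconstE c : funconst d f c = iota c%:P%:P.
Proof.
apply/val_inj; rewrite /= map_polyC -[RHS]/(polyn (in_qpoly D _)) in_qpoly_small //.
by rewrite mk_monic_defining size_defining_poly // (leq_ltn_trans (size_polyC_leq1 _)) ?ltnS.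
Qed.

Lemma fun_xE : fun_x d f = iota 'X%:P.
Proof.
apply/val_inj; rewrite /= map_polyC -[RHS]/(polyn (in_qpoly D _)) in_qpoly_small //.
by rewrite mk_monic_defining size_defining_poly // (leq_ltn_trans (size_polyC_leq1 _)) ?ltnS.
Qed.

Lemma fun_yE : fun_y d f = iota 'X.
Proof. by rewrite /fun_y /qpolyX /= map_polyX. Qed.

Lemma is_valuationP v : is_valuation v <-> valuation (const_embed iota) v.
Proof.
by split=> -[H1 H2 H3 H4]; split=> // c c0; rewrite -(H3 c c0) funconstE.
Qed.

Lemma centered_affine (p : affine_point d f) v : centered_at (Some p) v <->
  0 < v (iota ('X - (val p).1%:P)%:P) /\ 0 < v (iota ('X - (val p).2%:P%:P)).
Proof.
rewrite /centered_at fun_xE fun_yE !funconstE -!(rmorphB iota) -polyCB.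
by [].
Qed.

Lemma centered_infty v : centered_at (infty d f) v <-> v (iota 'X%:P) < 0.
Proof. by rewrite /= fun_xE. Qed.

End Model.

(** * Orders of vanishing and integral closedness *)

Section Places.
Variables (K : closedFieldType) (n d : nat) (f : {poly K}).
Hypotheses (d_gt1 : (1 < d)%N) (co_nd : coprime n d) (dK : d%:R != 0 :> K).
Hypotheses (f_monic : f \is monic) (szf : size f = n.+1) (f_simple : no_repeated_roots f).
Implicit Types (g : {poly {poly K}}) (p : affine_point d f) (P : point d f).

Let d_gt0 : (0 < d)%N. Proof. exact: ltnW. Qed.
Local Notation iota := (coord_ring_map d f).
Local Notation cst := (const_embed iota).
Local Notation phi := (weight_poly n d).
Let se : superelliptic n d f iota := coord_ring_superelliptic d_gt1 co_nd szf f_monic.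
Let L_unit := se_unit se.

Lemma affine_eq p : (val p).2 ^+ d = f.[(val p).1].
Proof. exact/eqP/(valP p). Qed.

Lemma root_simple a : f.[a] = 0 -> exists2 q, f = ('X - a%:P) * q & q.[a] != 0.
Proof.
move=> fa; have [q Eq] := poly_root_factor fa; exists q => //.
apply/negP => /eqP /poly_root_factor [r Er].
by case/negP: (f_simple a); apply/dvdpP; exists r; rewrite Eq Er; ring.
Qed.

Lemma affine_smooth p : (val p).2 = 0 ->
  exists2 q, f = ('X - (val p).1%:P) * q & q.[(val p).1] != 0.
Proof.
by move=> b0; apply: root_simple; rewrite -affine_eq b0 expr0n eqn0Ngt d_gt0.
Qed.

(** [ord] is chosen by [epsilon], so its characteristic properties rest on
    [affine_valuation_exists]. *)
Lemma ord_affineP p : [/\ valuation cst (ord (Some p)),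
  0 < ord (Some p) (iota ('X - (val p).1%:P)%:P)
  & 0 < ord (Some p) (iota ('X - (val p).2%:P%:P))].
Proof.
have [v [v1 v2 v3]] := affine_valuation_exists se d_gt1 dK (affine_eq p) (@affine_smooth p).
have := epsilon_spec (inhabits (fun=> 0))
  (fun v => is_valuation v /\ centered_at (Some p) v).
case.
  by exists v; split; [apply/is_valuationP | apply/centered_affine].
by move=> /(is_valuationP d_gt1) H1 /(centered_affine d_gt1) [H2 H3].
Qed.

Lemma ord_inftyP : valuation cst (ord (infty d f)) /\ ord (infty d f) (iota 'X%:P) < 0.
Proof.
have [v [v1 v2]] := inf_valuation_exists se.
have := epsilon_spec (inhabits (fun=> 0))
  (fun v => is_valuation v /\ centered_at (infty d f) v).
case.
  by exists v; split; [apply/is_valuationP | apply/centered_infty].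
by move=> /(is_valuationP d_gt1) H1 /(centered_infty d_gt1) H2.
Qed.

Lemma ord_valuation P : valuation cst (ord P).
Proof. by case: P => [p|]; [case: (ord_affineP p) | case: ord_inftyP]. Qed.

Lemma ordM P u w : u != 0 -> w != 0 -> ord P (u * w) = ord P u + ord P w.
Proof. exact: (valM (ord_valuation P)). Qed.

Lemma ordX P u k : u != 0 -> ord P (u ^+ k) = ord P u * k%:Z.
Proof. by move=> u0; rewrite (valX L_unit (ord_valuation P)) // mulrn_int. Qed.

Lemma ord_infty g : (size g <= d)%N -> g != 0 ->
  ord (infty d f) (iota g) = - (size (phi g)).-1%:Z.
Proof. by case: ord_inftyP => H1 H2; exact: (val_inf se H1 H2). Qed.

Local Notation ev p g := (eval2 (val p).1 (val p).2 g).

Lemma ord_affine_ge0 p g : iota g != 0 -> 0 <= ord (Some p) (iota g).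
Proof. by case: (ord_affineP p) => H1 H2 H3; apply: (val_iota_ge0 H1 H2 H3). Qed.

Lemma ord_affine_gt0 p g : iota g != 0 -> ev p g = 0 -> 0 < ord (Some p) (iota g).
Proof. by case: (ord_affineP p) => H1 H2 H3; apply: (val_iota_gt0 H1 H2 H3). Qed.

Lemma ord_affine_eq0 p g : ev p g != 0 -> ord (Some p) (iota g) = 0.
Proof. by case: (ord_affineP p) => H1 H2 H3; apply: (val_iota_eq0 H1 H2 H3). Qed.

Lemma ord_x_sub p : (val p).2 != 0 -> ord (Some p) (iota ('X - (val p).1%:P)%:P) = 1.
Proof.
case: (ord_affineP p) => H1 H2 H3 b0.
exact: (val_x_sub se d_gt1 dK (affine_eq p) (@affine_smooth p) H1 H2 H3 b0).
Qed.

Lemma fiber_ex a b : b ^+ d = f.[a] ->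
  exists p : affine_point d f, (val p).1 = a /\ (val p).2 = b.
Proof. by move=> /eqP E; exists (exist (fun q : K * K => q.2 ^+ d == f.[q.1]) (a, b) E). Qed.

(** The fibre over [a] has [d] distinct points, which give [d] roots of the polynomial [g(a, y)] of
    degree below [d]. *)
Lemma ord_unramified_factor a g : f.[a] != 0 -> (size g <= d)%N ->
  (forall p, (val p).1 = a -> ev p g = 0) ->
  forall i, (g`_i).[a] = 0.
Proof.
move=> fa sg H; pose g' := map_poly (horner_eval a) g.
suff g'0 : g' = 0.
  by move=> i; have := congr1 (fun r : {poly K} => r`_i) g'0; rewrite coef_map coef0.
have [s [us ss sP]] := nth_roots d_gt0 dK fa.
apply/eqP; apply/negPn/negP => g'0.
have : (size s < size g')%N.
  apply: max_poly_roots => //; apply/allP => b; rewrite sP => /eqP.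
  move=> /fiber_ex [p [Ea Eb]]; have := H p Ea; rewrite Ea Eb /eval2 => E.
  apply/rootP; have -> : b = horner_eval a b%:P by rewrite /horner_eval hornerC.
  by rewrite horner_map.
by rewrite ss ltnNge (leq_trans _ sg) // size_poly.
Qed.

(** Here [v(x - a) = d v(y)]. If [j < d] is the least index with [g_j(a) <> 0], the term [g_j y^j]
    strictly dominates: earlier coefficients are divisible by [x - a], and later powers of [y] are
    higher. Then [v(g) = j v(y) < d v(y)], against the hypothesis. *)
Lemma ord_ramified_factor p g : (val p).2 = 0 -> (size g <= d)%N ->
  (g != 0 -> ord (Some p) (iota ('X - (val p).1%:P)%:P) <= ord (Some p) (iota g)) ->
  forall i, (g`_i).[(val p).1] = 0.
Proof.
move=> b0 sg le i; set a := (val p).1 in le *.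
apply/eqP/negPn/negP => gia.
have [j gja jmin] := ex_minnP (ex_intro (fun i => (g`_i).[a] != 0) i gia).
have hjd : (j < d)%N.
  rewrite ltnNge; apply: contra_neqN gja => lej.
  by rewrite nth_default ?horner0 // (leq_trans sg).
have [q Eq qa] := affine_smooth b0; rewrite -/a in Eq qa.
have [valv v_x v_y] := ord_affineP p; set v := ord (Some p) in valv v_x v_y le *.
have Y0 : iota 'X != 0 by exact: (iotaX_neq0 se).
have X0 : iota ('X - a%:P)%:P != 0 by rewrite (iotaC_neq0 se) // polyXsubC_eq0.
have vY : 0 < v (iota 'X) by move: v_y; rewrite b0 !polyC0 subr0.
have Evx : v (iota ('X - a%:P)%:P) = v (iota 'X) * d%:Z.
  have EY : iota 'X ^+ d = iota ('X - a%:P)%:P * iota q%:P.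
    by rewrite -(rmorphXn iota) -(rmorphM iota) (se_rel se) -polyCM -Eq.
  have q0 : iota q%:P != 0.
    by rewrite (iotaC_neq0 se) //; apply: contraNneq qa => ->; rewrite horner0.
  have vq : v (iota q%:P) = 0 by apply: ord_affine_eq0; rewrite eval2C.
  by have := ordX (Some p) d Y0; rewrite -/v => <-; rewrite EY /v ordM // -/v vq addr0.
pose F (k : 'I_d) := iota (g`_k)%:P * iota 'X ^+ k.
have g_neq0 k : (g`_k).[a] != 0 -> iota (g`_k)%:P != 0.
  by move=> ga; rewrite (iotaC_neq0 se) //; apply: contraNneq ga => ->; rewrite horner0.
have EF : v (F (Ordinal hjd)) = v (iota 'X) * j%:Z.
  have vg : v (iota (g`_j)%:P) = 0 by apply: ord_affine_eq0; rewrite eval2C.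
  by rewrite /F /v ordM ?(expL_neq0 L_unit) ?g_neq0 // ordX // -/v vg add0r.
have vgeY m k : (m <= k)%N -> vge v (v (iota 'X) * m%:Z) (iota 'X ^+ k).
  move=> lemk; rewrite /vge /v ordX // -/v; apply/orP; right.
  by rewrite ler_wpM2l ?lez_nat // ltW.
have lejd m : (j < m)%N -> v (iota 'X) * j%:Z + 1 <= v (iota 'X) * m%:Z.
  by move=> jm; rewrite lezD1 ltr_pM2l // ltz_nat.
have [|k kj|nz E] := val_dominant_sum valv (F := F) (i := Ordinal hjd).
- by rewrite /F (mulL_neq0 L_unit) ?(expL_neq0 L_unit) ?g_neq0.
- rewrite EF; case: (ltngtP k j) => [lt|gt|E]; last by case/eqP: kj; apply/val_inj.
    have /poly_root_factor [r Er] : (g`_k).[a] = 0.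
      by apply/eqP; apply: contraLR lt => ga; rewrite -leqNgt jmin.
    rewrite /F Er polyCM rmorphM -mulrA.
    apply: (@vgeW _ _ (v (iota 'X) * d%:Z + 0)); first by rewrite addr0 lejd.
    apply: (vgeM valv); first by rewrite -Evx vge_val.
    rewrite -(rmorphXn iota) -(rmorphM iota).
    exact: (vge_iota valv v_x v_y).
  rewrite /F; apply: (@vgeW _ _ (0 + v (iota 'X) * k%:Z)); first by rewrite add0r lejd.
  apply: (vgeM valv); last exact: vgeY.
  exact: (vge_iota valv v_x v_y).
rewrite -(iota_sum iota sg) in nz E.
have g0 : g != 0 by apply: contraNneq nz => ->; rewrite rmorph0.
by move: (le g0); rewrite Evx E EF leNgt => /negP; apply; rewrite -lezD1 lejd.
Qed.

(* The affine coordinate ring is integrally closed. *)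
Lemma regular_affine (h : funfield d f) : h != 0 ->
  (forall p, 0 <= ord (Some p) h) -> exists2 g : {poly {poly K}}, (size g <= d)%N & h = iota g.
Proof.
move=> h0 reg; have [g [q [q0 sg E]]] := se_frac se h.
(* Induction on the size of the denominator [q]: over a root [a] of [q], regularity of [h] makes [g]
   vanish at least as much as [x - a], so that this factor cancels. *)
elim: {q}(size q) {-2}q (leqnn (size q)) g q0 sg E => [|k IH] q szq g q0 sg E.
  by move: q0; rewrite -size_poly_eq0 -leqn0 szq.
have [/eqP /size_poly1P [c c0 Ec]|/closed_rootP [a /rootP ra]] := eqVneq (size q) 1%N.
  exists (c^-1%:P%:P * g); first by rewrite mul_polyC (leq_trans (size_scale_leq _ _)).
  rewrite rmorphM -E Ec mulrC -mulrA -rmorphM -!polyCM mulfV //.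
  by rewrite rmorph1 mulr1.
have [q1 Eq1] := poly_root_factor ra.
have q10 : q1 != 0 by apply: contraNneq q0 => z; rewrite Eq1 z mulr0.
have X0 : 'X - a%:P != 0 :> {poly K} by rewrite polyXsubC_eq0.
have iX0 := iotaC_neq0 se X0; have iq10 := iotaC_neq0 se q10.
have Eord p : ord (Some p) (iota g) = ord (Some p) h +
    (ord (Some p) (iota ('X - a%:P)%:P) + ord (Some p) (iota q1%:P)).
  by rewrite -E Eq1 polyCM rmorphM !ordM // mulL_neq0.
have ge p : ord (Some p) (iota ('X - a%:P)%:P) <= ord (Some p) (iota g).
  by rewrite Eord; have := reg p; have := ord_affine_ge0 p iq10; lia.
have ga i : (g`_i).[a] = 0.
  have [fa|fa] := eqVneq f.[a] 0.
    have /fiber_ex [p [Ea Eb]] : 0 ^+ d = f.[a] by rewrite fa expr0n eqn0Ngt d_gt0.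
    by rewrite -Ea; apply: ord_ramified_factor => //; rewrite Ea.
  apply: (ord_unramified_factor fa sg) => p Ea; apply/eqP/negPn/negP => nz.
  have := ge p; rewrite (ord_affine_eq0 nz) leNgt => /negP; apply.
  by apply: ord_affine_gt0 => //; rewrite eval2C Ea !hornerE subrr.
have [g1 sg1 Eg1] : exists2 g1 : {poly {poly K}}, (size g1 <= d)%N & g = ('X - a%:P)%:P * g1.
  exists (\poly_(i < d) (g`_i %/ ('X - a%:P))); first exact: size_poly.
  apply/polyP => i; rewrite coefCM coef_poly; case: ltnP => le.
    by rewrite mulrC divpK // dvdp_XsubCl; apply/rootP.
  by rewrite nth_default ?mulr0 // (leq_trans sg).
apply: (IH q1 _ g1) => //.
  by move: szq; rewrite Eq1 size_mul // size_XsubC.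
apply: (mulLI L_unit iX0); rewrite -[RHS]rmorphM -Eg1 -E Eq1 polyCM rmorphM.
by rewrite mulrCA.
Qed.

(** * Torsion points *)

Lemma coeff_jac P Q m :
  coeff Q (jac_divisor P *+ m - 0) = ((P == Q)%:R - (infty d f == Q)%:R) * m%:Z.
Proof. by rewrite subr0 raddfMn /= raddfB /= !coeffU !mul1r mulrn_int. Qed.

(** A function with divisor [m(P) - m(infty)] is regular on the affine curve, hence the image of
    some [g] by [regular_affine]; its pole order is the degree of [phi g]. *)
Lemma torsion_affine m p : torsion_point m (Some p) <-> exists g,
  [/\ (size g <= d)%N, g != 0, (size (phi g)).-1 = m,
      ord (Some p) (iota g) = m%:Z
    & forall q, q != p -> ord (Some q) (iota g) = 0].
Proof.
split=> [[h h0 H]|[g [sg g0 Em Ep Eq]]].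
  have Hp : ord (Some p) h = m%:Z by rewrite -H coeff_jac eqxx subr0 mul1r.
  have Hq q : q != p -> ord (Some q) h = 0.
    move=> qp; rewrite -H coeff_jac (_ : Some p == Some q = false) ?subrr ?mul0r //.
    by rewrite eq_sym; apply/negbTE.
  have Hi : ord (infty d f) h = - m%:Z by rewrite -H coeff_jac eqxx sub0r mulN1r.
  have [|g sg Eg] := regular_affine h0.
    by move=> q; case: (eqVneq q p) => [->|/Hq -> //]; rewrite Hp.
  have g0 : g != 0 by apply: contraNneq h0 => z; rewrite Eg z rmorph0.
  exists g; rewrite -Eg; split=> //.
  by move: Hi; rewrite Eg ord_infty // => /oppr_inj [].
exists (iota g); first by rewrite (iota_eq0 se).
case=> [q|]; rewrite coeff_jac; last by rewrite ord_infty // eqxx Em sub0r mulN1r.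
rewrite subr0; case: (eqVneq q p) => [->|qp]; first by rewrite Ep eqxx mul1r.
rewrite Eq // (_ : Some p == Some q = false) ?mul0r //.
by rewrite eq_sym; apply/negbTE.
Qed.

Lemma torsion_infty : torsion_point 1 (infty d f).
Proof.
exists 1; first exact: oner_neq0.
move=> P; rewrite coeff_jac subrr mul0r.
by rewrite (val1 (ord_valuation P)).
Qed.

Lemma point_eq p q : (val p).1 = (val q).1 -> (val p).2 = (val q).2 -> p = q.
Proof. by move=> H1 H2; apply/val_inj; move: H1 H2; case: (val p) (val q) => [? ?] [? ?] /= -> ->. Qed.

Lemma unique_fiber p : (forall q, (val q).1 = (val p).1 -> q = p) -> (val p).2 = 0.
Proof.
move=> H; apply/eqP; apply: contraTT isT => b0.
have fa : f.[(val p).1] != 0 by rewrite -affine_eq expf_neq0.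
have [s [us ss sP]] := nth_roots d_gt0 dK fa.
have : (size s <= size [:: (val p).2])%N.
  apply: uniq_leq_size => // b; rewrite sP => /eqP /fiber_ex [q [Ea Eb]].
  by rewrite inE -Eb (H q Ea).
by rewrite ss leqNgt d_gt1.
Qed.

Lemma pole_bound g i : (size g <= d)%N -> g`_i != 0 ->
  (d * (size (g`_i)%R).-1 + n * i <= (size (phi g)).-1)%N.
Proof.
move=> sg gi; have := leq_size_weight_term d_gt0 co_nd i sg; rewrite size_weight_term //.
by case: (size (phi g)).
Qed.

Lemma ord_zero_unique m p g : g != 0 -> (size g <= d)%N -> 
  (forall q, q != p -> ord (Some q) (iota g) = 0) -> ord (Some p) (iota g) = m ->
  forall q, ev q g = 0 -> q = p.
Proof.
move=> g0 sg Hq _ q eq0; apply/eqP; apply: contraTT isT => qp.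
have : 0 < ord (Some q) (iota g) by apply: ord_affine_gt0; rewrite ?(iota_eq0 se).
by rewrite Hq.
Qed.

(** A pole order below [n] excludes [y], so [g = q(x)]. Every root of [q] is the abscissa [a] of the
    point, and the fibre over [a] is that point alone; so [b = 0], and [q] is a multiple of
    [(x - a)^k] with [m = d k]. *)
Lemma small_torsion m p : (0 < m < n)%N -> torsion_point m (Some p) ->
  [/\ (val p).2 = 0, (d %| m)%N & torsion_point d (Some p)].
Proof.
move=> /andP[m0 mn] /torsion_affine [g [sg g0 Em Ep Eq]].
have Eg : g = (g`_0)%:P.
  apply/polyP => -[|i]; rewrite coefC //=; apply/eqP/negPn/negP => gi.
  have := pole_bound sg gi; rewrite Em leqNgt => /negP; apply.
  by apply: leq_trans mn _; rewrite mulnS addnCA leq_addr.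
set q := g`_0 in Eg; have q0 : q != 0 by apply: contraNneq g0 => z; rewrite Eg z.
have Emq : m = (d * (size q).-1)%N by rewrite -Em Eg size_weight_polyC.
have uq := ord_zero_unique g0 sg Eq Ep.
have qroot z : root q z -> forall r, (val r).1 = z -> r = p.
  by move=> /rootP qz r Er; apply: uq; rewrite Eg eval2C Er.
have rooteq z : root q z -> z = (val p).1.
  move=> qz; have [b Eb] := closed_root_exp f.[z] d_gt0.
  have [r [Er _]] := fiber_ex Eb.
  by rewrite -(qroot _ qz _ Er).
have [z qz] : exists z, root q z.
  apply/closed_rootP; apply: contraTneq m0 => sq1.
  by rewrite Emq sq1 muln0.
have ez := rooteq z qz; rewrite ez in qz.
have uf := qroot _ qz.
have Epow := single_root_power q0 rooteq.
set a := (val p).1 in qz uf Epow *; set k := (size q).-1 in Emq Epow.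
have X0 : iota ('X - a%:P)%:P != 0 by rewrite (iotaC_neq0 se) // polyXsubC_eq0.
(* The order [d k] of [g] is divided by [k > 0]; thus [x - a] itself has divisor
   [d(P) - d(infty)]. *)
have ord_xa : ord (Some p) (iota ('X - a%:P)%:P) = d%:Z.
  have lq0 : lead_coef q != 0 by rewrite lead_coef_eq0.
  have : ord (Some p) (iota g) = ord (Some p) (iota ('X - a%:P)%:P) * k%:Z.
    rewrite Eg Epow -mul_polyC polyCM polyC_exp rmorphM rmorphXn.
    rewrite ordM ?(expL_neq0 L_unit) ?(iotaC_neq0 se) ?polyC_eq0 ?polyXsubC_eq0 //.
    by rewrite ordX // ord_affine_eq0 ?add0r // eval2C hornerC.
  rewrite Ep Emq PoszM => /mulIf -> //.
  by rewrite eqz_nat; apply: contraTneq m0 => k0; rewrite Emq k0 muln0.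
split; first exact: unique_fiber.
  by rewrite Emq dvdn_mulr.
apply/torsion_affine; exists ('X - a%:P)%:P; split=> //.
- exact: leq_trans (size_polyC_leq1 _) _.
- by rewrite polyC_eq0 polyXsubC_eq0.
- by rewrite size_weight_polyC ?polyXsubC_eq0 // size_XsubC muln1.
move=> r rp; apply: ord_affine_eq0; rewrite eval2C !hornerE subr_eq0.
by apply: contraNneq rp => /uf ->.
Qed.

(** For [m < n], [small_torsion] gives [d <= m] and a [d]-torsion point, so minimality of [m] leaves
    only [m = d]. *)
Theorem order_dichotomy P m : (1 < m)%N -> has_order P m -> m = d \/ (n <= m)%N.
Proof.
case: P => [p|] m1 [m0 tm minm]; last by case: (minm 1%N); [rewrite m1 | exact: torsion_infty].
case: (leqP n m) => [le|lt]; [by right | left].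
have [|_ dm td] := small_torsion _ tm; first by rewrite m0.
have := dvdn_leq m0 dm; rewrite leq_eqVlt => /orP[/eqP->//|ltd].
by case: (minm d); rewrite ?d_gt0.
Qed.

Hypothesis dn : (d < n)%N.

Let n_gt0 : (0 < n)%N. Proof. exact: leq_trans dn. Qed.

Lemma d_ndvd_n : ~~ (d %| n)%N.
Proof.
apply: contraL co_nd => dv; rewrite /coprime (gcdn_idPr dv).
by rewrite neq_ltn d_gt1 orbT.
Qed.

(** If [g(a) = 0], then [(x - a)^2] divides both [g^d] and [(x - a)^n], hence [f]. *)
Lemma split_value_neq0 a (g : {poly K}) : power_split n d f a g -> g.[a] != 0.
Proof.
move=> [_ E]; apply/eqP => /poly_root_factor [r Er].
case/negP: (f_simple a); rewrite E Er exprMn dvdp_addr.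
  by rewrite dvdp_exp2l // (leq_trans d_gt1 (ltnW dn)).
by rewrite dvdp_mulr // dvdp_exp2l.
Qed.

(** A function of pole order [n] is [g_0(x) + c y], with [c <> 0] because [d] does not divide [n];
    up to scaling it is [y - g(x)]. A root [z] of the monic polynomial [f - g^d] of degree [n]
    yields its zero [(z, g(z))], so the abscissa of [p] is the only root. *)
Lemma torsion_split p : torsion_point n (Some p) ->
  exists2 g : {poly K}, power_split n d f (val p).1 g & g.[(val p).1] = (val p).2.
Proof.
move=> /torsion_affine [G [sG G0 Em Ep Eq]].
have uq := ord_zero_unique G0 sG Eq Ep.
have pb i : G`_i != 0 -> (d * (size (G`_i)%R).-1 + n * i <= n)%N.
  by move=> Gi; rewrite -[X in (_ <= X)%N]Em; apply: pole_bound.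
pose c := G`_1`_0.
have EG1 : G`_1 = c%:P.
  apply: size1_polyC; case: (eqVneq G`_1 0) => [->|/pb]; first by rewrite size_poly0.
  rewrite muln1 -{2}(add0n n) leq_add2r leqn0 muln_eq0 eqn0Ngt d_gt0 /=.
  by case: (size _) => [|[]].
have EG : G = (G`_0)%:P + c%:P *: 'X.
  apply/polyP => i; rewrite coefD coefC coefZ coefX.
  case: i => [|[|i]] /=; rewrite ?mulr0 ?addr0 ?mulr1 ?add0r //.
  apply/eqP/negPn/negP => /pb; rewrite leqNgt => /negP; apply.
  rewrite !mulnS; move: n_gt0 (d * _)%N (n * i)%N; clear.
  by move=> n0 u v; rewrite addnCA -[X in (X < _)%N]addn0 ltn_add2l addnCA ltn_addr.
have c0 : c != 0.
  apply: contraNneq d_ndvd_n => c0; rewrite -Em {1}EG c0 polyC0 scale0r addr0.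
  case: (eqVneq G`_0 0) => [z|nz].
    by case/eqP: G0; rewrite EG z c0 !polyC0 scale0r addr0.
  by rewrite size_weight_polyC // dvdn_mulr.
pose g := - (c^-1 *: G`_0).
have sg : (d * (size g).-1 < n)%N.
  rewrite /g size_polyN size_scale ?invr_eq0 //.
  case: (eqVneq G`_0 0) => [->|/pb]; first by rewrite size_poly0 muln0.
  rewrite muln0 addn0 leq_eqVlt => /orP[/eqP E|//].
  by move: d_ndvd_n; rewrite -{1}E dvdn_mulr.
have EGg : G = c%:P%:P * ('X - g%:P).
  rewrite {1}EG /g polyCN opprK -mul_polyC mulrDr addrC; congr (_ + _).
  by rewrite -polyCM -mul_polyC mulrA -polyCM mulfV // mul1r.
have sgd : (size (g ^+ d)%R <= n)%N.
  have := size_exp g d; rewrite mulnC; move: sg n_gt0.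
  by move: (size (g ^+ d)) (d * _)%N; clear; lia.
have R_monic : f - g ^+ d \is monic.
  by rewrite monicE lead_coefDl ?size_polyN ?szf ?ltnS // -monicE.
have sR : size (f - g ^+ d) = n.+1 by rewrite size_polyDl ?size_polyN szf.
have rootR z : root (f - g ^+ d) z -> z = (val p).1 /\ g.[z] = (val p).2.
  move=> /rootP; rewrite !hornerE => /eqP; rewrite subr_eq0 => /eqP Ez.
  have [q [Eq1 Eq2]] := fiber_ex (esym Ez).
  have <- : q = p; last by rewrite Eq1 Eq2.
  apply: uq; rewrite EGg eval2M -polyCN eval2D eval2X eval2C Eq1 Eq2 eval2C.
  by rewrite !hornerE subrr mulr0.
have R0 : f - g ^+ d != 0 by rewrite monic_neq0.
have [z rz] : exists z, root (f - g ^+ d) z.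
  by apply/closed_rootP; rewrite sR eqSS -lt0n.
exists g; last by have [<- ->] := rootR z rz.
split=> //; apply/eqP; rewrite addrC -subr_eq; apply/eqP.
rewrite [LHS](single_root_power R0 (fun z rz => proj1 (rootR z rz))).
by rewrite (monicP R_monic) scale1r sR.
Qed.

(** At a zero of [y - g(x)] one has [f = g^d], so [x = a] and the zero is [p]. Its order there is
    that of [(x - a)^n], since the cofactor [conj_sum] does not vanish at [p]; and [x - a] has order
    1 because [b <> 0]. *)
Lemma split_torsion p (g : {poly K}) : power_split n d f (val p).1 g -> g.[(val p).1] = (val p).2 ->
  torsion_point n (Some p).
Proof.
move=> S Eg; have b0 := split_value_neq0 S; rewrite Eg in b0; case: S => sg Ef.
set a := (val p).1 in Eg sg Ef *; pose G : {poly {poly K}} := 'X - g%:P.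
have G0 : G != 0 by rewrite polyXsubC_eq0.
have sG : (size G <= d)%N by rewrite size_XsubC.
have Efg : f - g ^+ d = ('X - a%:P) ^+ n by rewrite {1}Ef addrC addKr.
have evG q : eval2 (val q).1 (val q).2 G = (val q).2 - g.[(val q).1].
  by rewrite /G -polyCN eval2D eval2X eval2C hornerN.
have zero q : eval2 (val q).1 (val q).2 G = 0 -> q = p.
  rewrite evG => /eqP; rewrite subr_eq0 => /eqP Eq2.
  have := congr1 (fun r : {poly K} => r.[(val q).1]) Ef.
  rewrite /= !hornerE -affine_eq Eq2 => /esym/(canRL (addKr _)).
  rewrite addNr => /eqP; rewrite expf_eq0 n_gt0 subr_eq0 => /eqP Ea.
  by apply: point_eq => //; rewrite Eq2 Ea Eg.
apply/torsion_affine; exists G; split=> //.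
- have phiG : phi G = 'X^n - (g \Po 'X^d).
    by rewrite /G -polyCN weight_polyD weight_polyC -['X]expr1 weight_polyXn muln1 raddfN.
  rewrite phiG size_polyDl ?size_polyXn ?size_polyN // ltnS.
  apply: leq_trans (size_comp_poly_leq _ _) _.
  by rewrite size_polyXn mulnC.
- have iG0 : iota G != 0 by rewrite (iota_eq0 se).
  have evS : eval2 a (val p).2 (conj_sum d g%:P) != 0.
    by apply: (eval2_conj_sum se dK b0); rewrite eval2C.
  have iS0 : iota (conj_sum d g%:P) != 0.
    exact: (iota_eval2_neq0 se (affine_eq p) evS).
  have X0 : iota ('X - a%:P)%:P != 0 by rewrite (iotaC_neq0 se) // polyXsubC_eq0.
  have E : iota G * iota (conj_sum d g%:P) = iota ('X - a%:P)%:P ^+ n.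
    rewrite -(rmorphM iota) conj_sumE (rmorphB iota) (se_rel se) -(rmorphB iota).
    by rewrite -polyC_exp -polyCB Efg polyC_exp (rmorphXn iota).
  have : ord (Some p) (iota ('X - a%:P)%:P ^+ n) = n%:Z.
    by rewrite ordX // ord_x_sub // mul1r.
  by rewrite -E ordM // [X in _ + X]ord_affine_eq0 // addr0.
- by move=> q qp; apply: ord_affine_eq0; apply: contraNneq qp => /zero ->.
Qed.

Lemma torsion_ramified_neq0 p : torsion_point n (Some p) -> (val p).2 != 0.
Proof. by move=> /torsion_split [g /split_value_neq0 + <-]. Qed.

(** A smaller torsion exponent would force [b = 0] by [small_torsion], but [b = g(a)] is nonzero. *)
Lemma torsion_has_order P : P <> infty d f -> torsion_point n P -> has_order P n.
Proof.
case: P => [p|] // _ tp; split=> // k kn tk.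
have [b0 _ _] := small_torsion kn tk.
by have := torsion_ramified_neq0 tp; rewrite b0 eqxx.
Qed.

(** Every point over [a] has [y = z g(a)] with [z^d = 1], and [z g] splits [f] just as [g] does. *)
Lemma split_fiber_torsion a (g : {poly K}) p : power_split n d f a g -> (val p).1 = a ->
  torsion_point n (Some p).
Proof.
move=> S Ea; have ga := split_value_neq0 S.
pose z := (val p).2 / g.[a].
have zd : z ^+ d = 1.
  rewrite expr_div_n affine_eq Ea (proj2 S) !hornerE subrr expr0n eqn0Ngt n_gt0 /=.
  by rewrite addr0 divff // expf_neq0.
apply: (@split_torsion p (z *: g)); rewrite Ea.
  split; last by rewrite exprZn zd scale1r; exact: (proj2 S).
  by rewrite (leq_ltn_trans _ (proj1 S)) // leq_mul2l -!subn1 leq_sub2r ?size_scale_leq ?orbT.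
by rewrite hornerZ divfK.
Qed.

Lemma orbit_fiber p P : (val p).2 != 0 ->
  (exists z, P = mu_act z (Some p)) <-> exists2 q, P = Some q & (val q).1 = (val p).1.
Proof.
move=> b0; split=> [[g ->]|[q -> Eq]]; first by eexists.
have zd : d.-unity_root ((val q).2 / (val p).2).
  apply/unity_rootP; rewrite expr_div_n !affine_eq Eq divff //.
  by rewrite -affine_eq expf_neq0.
exists (exist (fun z : K => d.-unity_root z) _ zd); congr Some; apply: point_eq => //=.
by rewrite divfK.
Qed.

Hypothesis split_unique : forall (a1 a2 : K) (g1 g2 : {poly K}),
  power_split n d f a1 g1 -> power_split n d f a2 g2 -> a1 = a2.

Lemma torsion_same_x p (q : affine_point d f) : torsion_point n (Some p) -> torsion_point n (Some q) ->
  (val p).1 = (val q).1.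
Proof.
by move=> /torsion_split [g1 S1 _] /torsion_split [g2 S2 _]; exact: split_unique S1 S2.
Qed.

(** The orbit of infinity is trivial, so a packet is the orbit of an affine point with [b <> 0],
    that is, a whole fibre. *)
Lemma packet_fiber (O : point d f -> Prop) : is_packet n O ->
  exists p, torsion_point n (Some p) /\
  forall P, O P <-> exists2 q, P = Some q & (val q).1 = (val p).1.
Proof.
move=> [[[p|] HO] [P [Q [OP OQ PQ]]] tO]; last first.
  by case: PQ; move/HO: OP => [? ->]; move/HO: OQ => [? ->].
have Op : O (Some p).
  have one : d.-unity_root (1 : K) by apply/unity_rootP; rewrite expr1n.
  by apply/HO; exists (exist (fun z : K => d.-unity_root z) 1 one); congr Some; apply: point_eq => //=; rewrite mul1r.
have tp := tO _ Op; exists p; split=> // R.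
rewrite HO; exact: orbit_fiber (torsion_ramified_neq0 tp).
Qed.

Lemma packet_unique (O O' : point d f -> Prop) : is_packet n O -> is_packet n O' -> forall P, O P <-> O' P.
Proof.
move=> /packet_fiber [p [tp HO]] /packet_fiber [p' [tp' HO']] P.
by rewrite HO HO' (torsion_same_x tp tp').
Qed.

(** If one point of order [n] exists, uniqueness of the splitting puts all of them in its fibre, and
    conversely this whole fibre, of [d] points, has order [n]. *)
Lemma order_points : exists s : seq (point d f),
  [/\ uniq s, forall P, P \in s <-> has_order P n & size s = 0%N \/ size s = d].
Proof.
have not_inf : ~ has_order (infty d f) n.
  case=> _ _ /(_ 1%N); case; first by rewrite (ltn_trans _ dn).
  exact: torsion_infty.
have [[p op]|none] := classic (exists p : affine_point d f, has_order (Some p : point d f) n);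
    last first.
  exists [::]; split=> //; last by left.
  by move=> [p|]; split=> // op; case: none; exists p.
have tp : torsion_point n (Some p) by case: op.
have b0 := torsion_ramified_neq0 tp.
have fa : f.[(val p).1] != 0 by rewrite -affine_eq expf_neq0.
have [s [us ss sP]] := nth_roots d_gt0 dK fa.
pose pts : seq (affine_point d f) := pmap insub [seq ((val p).1, b) | b <- s].
exists [seq Some q | q <- pts].
have [g S _] := torsion_split tp.
split.
- rewrite map_inj_uniq; last by move=> ? ? [].
  by rewrite pmap_sub_uniq // map_inj_uniq // => ? ? [].
- case=> [q|]; last by split=> //; case/mapP.
  rewrite mem_map; last by move=> ? ? [].
  rewrite mem_pmap_sub; split=> [/mapP [b _ E]|oq].
    by apply: torsion_has_order => //; apply: (split_fiber_torsion S); rewrite E.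
  have tq : torsion_point n (Some q) by case: oq.
  apply/mapP; exists (val q).2; first by rewrite sP affine_eq (torsion_same_x tp tq).
  by rewrite (torsion_same_x tp tq); case: (val q).
right; rewrite size_map size_pmap_sub count_map (@eq_in_count _ _ predT).
  by rewrite count_predT ss.
by move=> b; rewrite sP /= => ->.
Qed.

End Places.

Lemma split_unique_cases (K : closedFieldType) (n d : nat) (f : {poly K}) :
  (2 <= d)%N -> (d < n)%N -> d%:R != 0 :> K -> no_repeated_roots f ->
  [\/ [pchar K] =i pred0 /\ ~~ (d %| n.-1)%N,
      [/\ [pchar K] =i pred0, d = n.-1 & (5 <= n)%N]
    | exists p k : nat, p \in [pchar K] /\ n = (p ^ k)%N] ->
  forall a1 a2 g1 g2, power_split n d f a1 g1 -> power_split n d f a2 g2 -> a1 = a2.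
Proof.
move=> d2 dn dK f_simple cases a1 a2 g1 g2 S1 S2.
have char0 m : [pchar K] =i pred0 -> m.+1%:R != 0 :> K.
  by move=> H; apply: natr_neq0_pchar => // p; rewrite H.
case: cases => [[H dvd]|[H Ed n5]|[p [k [pK En]]]].
- apply: (split_unique_degree dn S1 S2) => //.
  by case: (n) dn => // m _; exact: char0.
- have En : n = d.+1 by rewrite Ed prednK // (leq_trans _ n5).
  rewrite En in S1 S2 n5; apply: (split_unique_linear _ _ S1 S2) => // m.
  exact: char0.
- exact: (split_unique_pchar d2 dn dK S1 S2 f_simple pK En).
Qed.

(** * Quartics with points of order four over 0 and -1 *)

Section QuarticOrderFour.
Variable K : closedFieldType.
Hypotheses (K2 : 2 != 0 :> K) (K3 : 3 != 0 :> K).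

Definition order_four (f : {poly K}) := forall p : affine_point 3 f,
  (val p).1 = 0 \/ (val p).1 = -1 -> has_order (Some p : point 3 f) 4.

(** With [c^3 = 2], the two expressions [quartic s] and [quartic_alt s] of the same polynomial are
    splittings at 0 and at -1. *)
Lemma quartic_splits (s : K) : s ^+ 2 = 3 -> exists g1 g2,
  power_split 4 3 (quartic s) 0 g1 /\ power_split 4 3 (quartic s) (-1) g2.
Proof.
move=> s2; have [c c3] := closed_root_exp (2 : K) (isT : (0 < 3)%N).
have lin (g : {poly K}) : size g = 2 -> (3 * (size (c%:P * g)%R).-1 < 4)%N.
  move=> sg; have := size_scale_leq c g; rewrite sg -mul_polyC.
  by case: (size _) => [|[|[|]]].
have cube (g : {poly K}) : (c%:P * g) ^+ 3 = 2 * g ^+ 3.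
  by rewrite exprMn -polyC_exp c3 polyC_natr.
exists (c%:P * ('X + ((3 + s) / 6)%:P)), (c%:P * (- 'X + ((- 3 + s) / 6)%:P)).
split; split; rewrite ?cube ?polyC0 ?subr0 ?polyCN ?opprK ?polyC1.
- by apply: lin; rewrite size_XaddC.
- by rewrite addrC.
- by apply: lin; rewrite -[_%:P]opprK -opprD size_polyN size_XsubC.
- by rewrite quartic_altE // addrC.
Qed.

Lemma order_four_quartic (f : {poly K}) :
  f \is monic -> size f = 5%N -> no_repeated_roots f ->
  (order_four f <-> exists2 s : K, s ^+ 2 = 3 & f = quartic s).
Proof.
move=> fm sf fs; split=> [o4|[s s2 Ef]].
  (* The fibre over [a] is nonempty because [K] is algebraically closed, so the hypothesis does
     apply to some point. *)
  have split_at a : a = 0 \/ a = -1 -> exists g, power_split 4 3 f a g.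
    move=> Ha; have [b Eb] := closed_root_exp f.[a] (isT : (0 < 3)%N).
    have [p [Ea _]] := fiber_ex Eb.
    have [] := o4 p; first by rewrite Ea.
    move=> _ /(torsion_split (n := 4) (d := 3) isT isT K3 fm sf fs isT) [g S _] _.
    by exists g; rewrite -Ea.
  have [g1 S1] := split_at 0 (or_introl erefl).
  have [g2 S2] := split_at (-1) (or_intror erefl).
  exact: (quartic_split_sqrt3 K2 K3 S1 S2).
have [g1 [g2 []]] := quartic_splits s2; rewrite -Ef => S1 S2 p Hp.
apply: (torsion_has_order (n := 4) (d := 3) isT isT K3 fm sf fs isT) => //.
case: Hp => Ea.
  exact: (split_fiber_torsion (n := 4) (d := 3) isT isT K3 fm sf fs isT S1 Ea).
exact: (split_fiber_torsion (n := 4) (d := 3) isT isT K3 fm sf fs isT S2 Ea).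
Qed.

Lemma two_quartics : 11 != 0 :> K -> exists f1 f2 : {poly K}, f1 <> f2 /\
  forall f : {poly K},
    [/\ f \is monic, size f = 5%N, no_repeated_roots f & order_four f]
    <-> f = f1 \/ f = f2.
Proof.
move=> K11; have [s s2] := closed_root_exp (3 : K) (isT : (0 < 2)%N).
exists (quartic s), (quartic (- s)); split=> [/(quartic_inj K2 K3) /eqP|f].
  rewrite -addr_eq0 -mulr2n -mulr_natl mulf_eq0 (negPf K2) /=.
  by apply/negP; exact: sqrt3_neq0.
split=> [[fm sf fs /(order_four_quartic fm sf fs) [t t2 ->]]|].
  have /eqP : t ^+ 2 = s ^+ 2 by rewrite t2 s2.
  by rewrite eqf_sqr => /orP[] /eqP ->; [left | right].
have good t : t ^+ 2 = 3 -> f = quartic t ->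
    [/\ f \is monic, size f = 5%N, no_repeated_roots f & order_four f].
  move=> t2 Ef; have [fm sf] := quartic_monic t.
  have fs := quartic_no_repeated_roots K2 K3 K11 t2.
  rewrite -Ef in fm sf fs; split=> //.
  by apply/(order_four_quartic fm sf fs); exists t.
by case=> Ef; [apply: (good s) | apply: (good (- s))] => //; rewrite sqrrN.
Qed.

End QuarticOrderFour.

Theorem mainTheorem1 (K : closedFieldType) :
  (forall (n d : nat) (f : {poly K}),
     (2 <= d)%N -> (d < n)%N -> coprime n d ->
     (forall p : nat, p \in [pchar K] -> ~~ (p %| d)%N) ->
     f \is monic -> size f = n.+1 -> no_repeated_roots f ->
     (* (i) *)
     (forall (P : point d f) (m : nat),
        (1 < m)%N -> has_order P m -> m = d \/ (n <= m)%N)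
     /\
     (* (ii) *)
     ([\/ [pchar K] =i pred0 /\ ~~ (d %| n.-1)%N,
          [/\ [pchar K] =i pred0, d = n.-1 & (5 <= n)%N]
        | exists p k : nat, p \in [pchar K] /\ n = (p ^ k)%N] ->
      (forall O O' : point d f -> Prop,
         is_packet n O -> is_packet n O' -> forall P, O P <-> O' P)
      /\
      (exists s : seq (point d f),
         [/\ uniq s, forall P, P \in s <-> has_order P n
           & size s = 0%N \/ size s = d])))
  /\
  (* (iii) *)
  (2%N \notin [pchar K] -> 3%N \notin [pchar K] ->
   let ord4 (f : {poly K}) := forall p : affine_point 3 f,
     (val p).1 = 0 \/ (val p).1 = -1 -> has_order (Some p : point 3 f) 4 in
   [/\ forall s : K, s ^+ 2 = 3%:R -> quartic s = quartic_alt s,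
       forall f : {poly K},
         f \is monic -> size f = 5%N -> no_repeated_roots f ->
         (ord4 f <-> exists2 s : K, s ^+ 2 = 3%:R & f = quartic s)
     (* Characteristic 11 is excluded from the count: there one of the two
        quartics has a double root, see [quartic_char11]. *)
     & 11%N \notin [pchar K] ->
       exists f1 f2 : {poly K}, f1 <> f2 /\
         forall f : {poly K},
           [/\ f \is monic, size f = 5%N, no_repeated_roots f & ord4 f]
           <-> f = f1 \/ f = f2]).
Proof.
split=> [n d f d2 dn co dK fm sf fs|K2 K3].
  have dR : d%:R != 0 :> K by apply: natr_neq0_pchar => //; exact: ltnW.
  split=> [P m|cases]; first exact: order_dichotomy.
  have uniq_split := split_unique_cases d2 dn dR fs cases.
  split; first exact: (packet_unique d2 co dR fm sf fs dn uniq_split).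
  exact: (order_points d2 co dR fm sf fs dn uniq_split).
rewrite !inE /= in K2 K3; split.
- exact: quartic_altE.
- exact: order_four_quartic.
- by rewrite inE /= => K11; exact: two_quartics.
Qed.
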